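(* For every $\epsilon>0$, $$\lim_{n\to\infty}\mathbb{P}\left(\tfrac12 n\log n < \omega_n <(1+\epsilon)n\log n\right)= 1.$$
   Context: All logarithms are base $2$. For a positive integer $n$, the random Cayley sum graph on $\mathbb{F}_2^n$ is constructed as follows: choose a random subset $A\subset\mathbb{F}_2^n$ by including each element independently with probability $\frac12$; the graph has vertex set $\mathbb{F}_2^n$, and distinct vertices $x\neq y$ are adjacent if and only if $x+y\in A$. $\omega_n$ denotes the clique number (size of a largest complete subgraph) of this random graph. *)

(* Defs.v *)
From HB Require Import structures.
From mathcomp Require Import all_boot all_order all_algebra.
From mathcomp Require Import all_classical all_reals all_analysis.
Set Implicit Arguments.
Unset Strict Implicit.
Unset Printing Implicit Defensive.
Import Order.TTheory GRing.Theory Num.Theory.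
Import numFieldNormedType.Exports.
Local Open Scope ring_scope.

Section Graph.
Variable T : finType.

Definition is_clique (e : rel T) (S : {set T}) : bool :=
  [forall x in S, forall y in S, (x != y) ==> e x y].

Definition clique_number (e : rel T) : nat :=
  (\max_(S : {set T} | is_clique e S) #|S|)%N.

End Graph.

Definition cayley_sum_graph (V : finZmodType) (A : {set V}) : rel V :=
  fun x y => (x != y) && (x + y \in A).

Section RandomSubset.
Variables (R : realType) (T : finType).

(* Joint mass function of the independent Bernoulli(p) indicators [x \in A]. *)
Definition random_subset_mass (p : R) (A : {set T}) : R :=
  \prod_(x : T) (if x \in A then p else 1 - p).

Definition random_subset_prob (p : R) (E : pred {set T}) : R :=
  \sum_(A : {set T} | E A) random_subset_mass p A.

End RandomSubset.

Definition log2 (R : realType) (x : R) : R := ln x / ln 2.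

(* For x != y the sum x + y is nonzero, so membership of 0 in A is irrelevant,
   but 0 is nevertheless included with probability 1/2 like any other element. *)
Definition omega (n : nat) (A : {set 'rV['F_2]_n}) : nat :=
  clique_number (cayley_sum_graph A).

(* Main.v *)
Require Import Defs.
From HB Require Import structures.
From mathcomp Require Import all_boot all_order all_algebra.
From mathcomp Require Import zify.
Set Implicit Arguments.
Unset Strict Implicit.
Unset Printing Implicit Defensive.
Import Order.TTheory GRing.Theory Num.Theory.

(** Write l for floor(log n).

    Lower bound: for k with 2^k <= n(l+1) < 2^(k+1), count the graphs of linear
    maps L : F_2^k -> F_2^(n-k) whose nonzero vectors all lie in A; each of them is
    a clique of size 2^k. Two graphs meet in a copy of ker (L - L'), so the ratio
    E X^2 / (E X)^2 is the average of 2^(|ker M| - 1) over all M, which tends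
    to 1 because few M have a large kernel.

    Upper bound: a clique X of size m = (1+eps) n l forces the nonzero part of
    X + X into A. By a union bound it suffices to find inside X + X a set W which is
    described by fewer than |W| bits; a subset Y of X of rank r costs n r + |Y| r
    bits. Let r be the rank of X.

    - If r <= l^3: either many pairs of X have unpopular sums, and then two subsets
      of X of size n already have more than 4 n r sums; or, after discarding a few
      elements of X, almost all sums are popular. Popular sums are all
      captured by S + T for two subsets S, T of size o(n), so only n r (1 + o(1))
      bits are needed, while edge-isoperimetry in the cube spanned by a basis
      contained in X shows that there are at least (1 + c) n r popular sums for
      some c > 0 depending on eps only.

    - If r > l^3: take Y in X with |Y| = 4 n and add greedily elements t of X
      whose translates t + Y bring at least 2 n new sums. Either 6 r steps succeed,
      or X lies in a container of size O(n r) determined by Y and at most 6 r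
      further elements. In the latter case every element of X costs only O(l)
      bits, X is described by at most 12 n r bits, and it has more than 13 n r
      sums because a set of size n^O(1) expands in a cube of dimension l^3. *)

(** * Sumsets and popular sums *)

Lemma card_disjU (T : finType) (A B : {set T}) :
  [disjoint A & B] -> #|A :|: B| = #|A| + #|B|.
Proof. by move=> dAB; apply/eqP; rewrite (leq_card_setU A B). Qed.

Lemma disjoint_setDl (T : finType) (A B : {set T}) : [disjoint A :\: B & B].
Proof. by rewrite -setI_eq0 setIDAC setDIl setDv setI0. Qed.

Section Combinatorics.
Variable V : finZmodType.
Hypothesis addvv : forall x : V, (x + x = 0)%R.

Definition sumset (S T : {set V}) : {set V} := [set (x + y)%R | x in S, y in T].

Definition translate (x : V) (S : {set V}) : {set V} := [set (x + y)%R | y in S].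

Lemma addvK (x : V) : involutive (+%R x).
Proof. by move=> y; rewrite addrA addvv add0r. Qed.

Lemma mem_translate x y (S : {set V}) : (y \in translate x S) = ((x + y)%R \in S).
Proof.
apply/imsetP/idP => [[z zS ->]|xyS]; first by rewrite addvK.
by exists (x + y)%R; rewrite ?addvK.
Qed.

Lemma card_translate x (S : {set V}) : #|translate x S| = #|S|.
Proof. by rewrite card_imset //; apply: addrI. Qed.

Lemma sumsetS (S S' T T' : {set V}) :
  S \subset S' -> T \subset T' -> sumset S T \subset sumset S' T'.
Proof.
move=> sS sT; apply/subsetP => _ /imset2P[x y xS yT ->].
by apply: imset2_f; [apply: (subsetP sS) | apply: (subsetP sT)].
Qed.

Lemma translate_sub x (S T : {set V}) : x \in T -> translate x S \subset sumset T S.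
Proof. by move=> xT; apply/subsetP => _ /imsetP[y yS ->]; apply: imset2_f. Qed.

Lemma card_sumset (S T : {set V}) : #|sumset S T| <= #|S| * #|T|.
Proof. by rewrite /sumset curry_imset2X -cardsX leq_imset_card. Qed.

Lemma sumset0l (T : {set V}) : sumset set0 T = set0.
Proof. by apply/setP => v; rewrite inE; apply/imset2P => -[x y]; rewrite inE. Qed.

(** Elements of [X] that bring at least [theta] new sums are added to [T] as long as there are any,
    at most [k] times. *)
Lemma greedy_sumset (X S : {set V}) theta k :
  exists T : {set V}, [/\ T \subset X, #|T| <= k &
    k * theta <= #|sumset T S| \/
    forall x, x \in X -> #|translate x S :\: sumset T S| < theta].
Proof.
elim: k => [|k [T [sTX cT [gain|closed]]]]; last by exists T; split; [|lia|right].
  by exists set0; rewrite sub0set cards0; split=> //; left.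
have [/existsP[x /andP[xX big]]|] :=
  boolP [exists x, (x \in X) && (theta <= #|translate x S :\: sumset T S|)].
  exists (x |: T); split.
  - by rewrite subUset sub1set xX.
  - by rewrite cardsU1; case: (x \notin T); lia.
  left; rewrite mulSn addnC; apply: leq_trans (leq_add gain big) _.
  rewrite -card_disjU; last by rewrite disjoint_sym disjoint_setDl.
  apply: subset_leq_card; rewrite subUset sumsetS ?subsetUr //=.
  by apply: subset_trans (subsetDl _ _) (translate_sub _ _); rewrite setU11.
move/existsPn => small; exists T; split=> //; first by lia.
by right=> x xX; move: (small x); rewrite xX /= -ltnNge.
Qed.

Definition reps (X : {set V}) (s : V) : {set V} := [set x in X | (x + s)%R \in X].

(* Elements forming at least [h] unpopular sums are discarded one at a time, and
   [E] records these sums. A given sum is recorded only once it has become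
   unpopular, which bounds its multiplicity in [E]. *)
Lemma popular_core (tau h : nat) (X : {set V}) :
  exists (X' : {set V}) (E : {set V * V}),
    [/\ X' \subset X, E \subset setX X X, h * #|X :\: X'| <= #|E|,
     forall s, #|[set p in E | (p.1 + p.2)%R == s]| <= tau &
     forall x, x \in X' ->
       #|[set y in X' | #|reps X' (x + y)%R| < tau]| < h].
Proof.
move: {2}#|X| (leqnn #|X|) => N; elim: N X => [|N IH] X cX.
  exists set0, set0; move: cX; rewrite leqn0 cards_eq0 => /eqP ->.
  split; [exact: sub0set|exact: sub0set|by rewrite setD0 cards0 muln0| |];
    last by move=> x; rewrite inE.
  by move=> s; rewrite (_ : [set _ in _ | _] = set0) ?cards0 //; apply/setP => p; rewrite !inE.
have [/existsP[x /andP[xX bad]]|good] := boolP [exists x, (x \in X) &&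
    (h <= #|[set y in X | #|reps X (x + y)%R| < tau]|)]; last first.
  exists X, set0; rewrite setDv cards0 muln0 sub0set; split=> // [s|x xX].
    by rewrite (_ : [set _ in _ | _] = set0) ?cards0 //; apply/setP => p; rewrite !inE.
  by move/existsPn/(_ x): good; rewrite xX /= -ltnNge.
have [|X' [E [sX' sE cE mE gX']]] := IH (X :\ x).
  by move: cX; rewrite (cardsD1 x X) xX.
pose E1 := [set (x, y) | y in [set y in X | #|reps X (x + y)%R| < tau]].
have sE1 : E1 \subset setX X X.
  apply/subsetP => p /imsetP[y]; rewrite inE => /andP[yX _] ->.
  by rewrite inE /= xX yX.
have sEX : E \subset setX X X.
  apply: subset_trans sE _; apply/subsetP => p; rewrite !inE.
  by move=> /andP[/andP[_ ->] /andP[_ ->]].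
have xX' : x \notin X' by apply/negP => /(subsetP sX'); rewrite !inE eqxx.
exists X', (E1 :|: E); split=> //.
- by apply: subset_trans sX' (subsetDl _ _).
- by rewrite subUset sE1.
- rewrite card_disjU; last first.
    apply/pred0P => -[a b] /=; apply/negbTE/negP => /andP[/imsetP[y _ [-> _]]].
    by move/(subsetP sE); rewrite !inE eqxx.
  rewrite card_imset; last by move=> y z /(congr1 snd).
  have := cardsD1 x (X :\: X'); rewrite inE xX xX' /= => ->.
  rewrite setDDl setUC -setDDl mulnDr muln1; exact: leq_add.
(* If [s] is a sum just recorded with [x], all recorded pairs of sum [s] are determined by their
   first component, which lies in [reps X s], a set of fewer than [tau] elements. Otherwise no new
   pair has sum [s]. *)
move=> s; case: (boolP [exists y, (y \in X) &&
    ((#|reps X (x + y)%R| < tau) && ((x + y)%R == s))]).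
  move=> /existsP[y /andP[yX /andP[few /eqP xys]]].
  rewrite xys in few; apply: leq_trans (ltnW few).
  rewrite -(card_in_imset (f := fst)).
    apply: subset_leq_card; apply/subsetP => a /imsetP[[c d]].
    rewrite !inE /= => /andP[cdE /eqP <-] ->; rewrite addvK.
    have : (c, d) \in setX X X.
      by case/orP: cdE => [/(subsetP sE1)|/(subsetP sEX)].
    by rewrite inE.
  move=> [a b] [c d]; rewrite !inE /= => /andP[_ /eqP e1] /andP[_ /eqP e2] e3.
  by subst c; congr (_, _); apply: (addrI a); rewrite e1 e2.
move/existsPn => none; apply: leq_trans (mE s).
apply: subset_leq_card; apply/subsetP => -[a b]; rewrite !inE /=.
case/andP => [/orP[|-> ->//]] /imsetP[y]; rewrite inE => /andP[yX few] [-> ->] ys.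
by move: (none y); rewrite yX few ys.
Qed.
End Combinatorics.

(** * Hitting sets and expansion in the cube *)

Lemma leq_expnl m n e : m <= n -> m ^ e <= n ^ e.
Proof. by case: e => // e; rewrite leq_exp2r. Qed.

Lemma leq_card_bigcup (I T : finType) (P : pred I) (A : I -> {set T}) :
  #|\bigcup_(i | P i) A i| <= \sum_(i | P i) #|A i|.
Proof.
elim/big_rec2: _ => [|i n B _ le_n]; first by rewrite cards0.
by apply: leq_trans (leq_card_setU _ _) _; rewrite leq_add2l.
Qed.

(** Bernoulli's inequality; it bounds by one half the chance that [d.+1] random points all miss a
    set of density [1 / d.+1]. *)
Lemma double_expn_pred d : 2 * d ^ d.+1 <= d.+1 ^ d.+1.
Proof.
have bern j : d ^ j.+1 + j.+1 * d ^ j <= d.+1 ^ j.+1.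
  elim: j => [|j IH]; first by rewrite !expn1 expn0; lia.
  rewrite [X in _ <= X]expnS; apply: leq_trans (leq_mul (leqnn _) IH).
  rewrite !expnS; nia.
by apply: leq_trans (bern d); rewrite [d ^ d.+1]expnS; lia.
Qed.

(* A uniformly random map from [c * t] points to [X] misses a fixed [D s] with
   probability at most [(1 - 1/c)^(c t) <= 2^-t]. *)
Lemma hitting_set (I J : finType) (F : {set I}) (D : I -> {set J}) (X : {set J}) c t :
  0 < #|X| -> (forall s, s \in F -> D s \subset X) ->
  (forall s, s \in F -> #|X| <= c * #|D s|) -> #|F| < 2 ^ t ->
  exists S : {set J}, [/\ S \subset X, #|S| <= c * t &
    forall s, s \in F -> 0 < #|S :&: D s|].
Proof.
move=> X0 sD cD cF; set a := c * t.
have [->|[s0 s0F]] := set_0Vmem F.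
  by exists set0; rewrite sub0set cards0; split=> // s; rewrite inE.
have c0 : 0 < c by move: (cD _ s0F); case: (c) X0 => //; lia.
have [/existsP[f /andP[fX hit]]|none] := boolP [exists f : {ffun 'I_a -> J},
    (f \in ffun_on (mem X)) &&
    [forall s in F, [exists i, f i \in D s]]].
  exists [set f i | i in 'I_a]; split.
  - by apply/subsetP => _ /imsetP[i _ ->]; move/ffun_onP: fX; apply.
  - by apply: leq_trans (leq_imset_card _ _) _; rewrite card_ord.
  move=> s sF; have /existsP[i fi] := forall_inP hit s sF.
  by rewrite card_gt0; apply/set0Pn; exists (f i); rewrite inE imset_f.
exfalso.
(* Every map into [X] misses some [D s], so the maps into the sets [X :\: D s] cover all of them. *)
have cov : #|X| ^ a <= \sum_(s in F) (#|X| - #|D s|) ^ a.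
  have -> : #|X| ^ a = #|[set f : {ffun 'I_a -> J} | f \in ffun_on (mem X)]|.
    by rewrite cardsE card_ffun_on card_ord.
  have sub : [set f : {ffun 'I_a -> J} | f \in ffun_on (mem X)] \subset
     \bigcup_(s in F) [set f : {ffun 'I_a -> J} | f \in ffun_on (mem (X :\: D s))].
    apply/subsetP => f; rewrite inE => fX.
    move/existsPn/(_ f): none; rewrite fX /= negb_forall_in => /existsP[s].
    move=> /andP[sF /existsPn nhit]; apply/bigcupP; exists s => //.
    rewrite inE; apply/ffun_onP => i; rewrite inE nhit /=.
    by move/ffun_onP: fX; apply.
  apply: leq_trans (subset_leq_card sub) _.
  apply: leq_trans (leq_card_bigcup _ _) _.
  apply: leq_sum => s sF; rewrite cardsE card_ffun_on card_ord.
  by rewrite cardsD (setIidPr (sD _ sF)).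
case: c c0 cD @a none cov => // d _ cD a none cov.
have key : d.+1 ^ a * #|X| ^ a <= #|F| * d ^ a * #|X| ^ a.
  rewrite -mulnA -!expnMn mulnC expnMn.
  apply: leq_trans (leq_mul cov (leqnn _)) _.
  rewrite big_distrl /= -sum_nat_const; apply: leq_sum => s sF.
  rewrite -expnMn; apply: leq_expnl.
  by have := cD _ sF; have := subset_leq_card (sD _ sF); nia.
rewrite leq_pmul2r ?expn_gt0 ?X0 // in key.
have pow : 2 ^ t * d ^ a <= d.+1 ^ a.
  by rewrite /a !expnM -expnMn; apply: leq_expnl; apply: double_expn_pred.
have : 2 ^ t * d ^ a <= #|F| * d ^ a := leq_trans pow key.
case: (posnP (d ^ a)) => [d0 _|d0]; last by rewrite leq_pmul2r // leqNgt cF.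
by move: key; rewrite d0 muln0 leqn0 expn_eq0.
Qed.

(** [hitting_set] is applied [k] times, each time to the sets [D s] without the points chosen so
    far; the subtracted [k * (c * t)] keeps what remains dense enough. *)
Lemma multi_hitting_set (I J : finType) (F : {set I}) (D : I -> {set J})
    (X : {set J}) c t k :
  0 < #|X| -> (forall s, s \in F -> D s \subset X) ->
  (forall s, s \in F -> #|X| <= c * (#|D s| - k * (c * t))) -> #|F| < 2 ^ t ->
  exists S : {set J}, [/\ S \subset X, #|S| <= k * (c * t) &
    forall s, s \in F -> k <= #|S :&: D s|].
Proof.
move=> X0 sD cD cF; elim: k cD => [|k IH] cD.
  by exists set0; rewrite sub0set cards0.
have [s sF|S [sSX cS kS]] := IH.
  apply: leq_trans (cD _ sF) _; rewrite leq_mul2l leq_sub2l ?orbT //.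
  by rewrite leq_mul2r leqnSn orbT.
have [s sF|s sF||S' [sS'X cS' kS']] := @hitting_set I J F (fun s => D s :\: S) X c t X0.
- by apply: subset_trans (subsetDl _ _) (sD _ sF).
- apply: leq_trans (cD _ sF) _; rewrite leq_mul2l; apply/orP; right.
  rewrite cardsD; apply: leq_sub2l; apply: leq_trans (subset_leq_card (subsetIr _ _)) _.
  by apply: leq_trans cS _; rewrite leq_mul2r leqnSn orbT.
- by [].
exists (S :|: S'); split.
- by rewrite subUset sSX.
- by rewrite mulSn addnC; apply: leq_trans (leq_card_setU _ _) (leq_add cS cS').
move=> s sF; rewrite setIUl; have := kS' s sF; have := kS s sF => k1 k2.
have : #|S :&: D s| + #|S' :&: (D s :\: S)| <= #|(S :&: D s) :|: (S' :&: D s)|.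
  rewrite -card_disjU.
    by apply: subset_leq_card; rewrite setUS // setIS // subsetDl.
  rewrite -setI_eq0; apply/eqP/setP => x; rewrite !inE.
  by case: (x \in S); rewrite ?andbF.
by apply: leq_trans; rewrite -addn1; apply: leq_add.
Qed.

(* Two-point form of the entropy inequality h(p) >= 2 min(p, 1 - p). *)
Lemma entropy_expn a b : b <= a -> a ^ a * b ^ b * 4 ^ b <= (a + b) ^ (a + b).
Proof.
move=> leba.
(* Arithmetic-geometric mean inequality for [b] numbers equal to 2 and [a - b] numbers equal to 1,
   whose sum is [a + b]. *)
have agm : 2 ^ b * a ^ a <= (a + b) ^ a.
  have [c ->] : exists c, a = b + c by exists (a - b); lia.
  pose E (i : 'I_b + 'I_c) : int := if i is inl _ then 2%R else 1%R.
  have [//|] := @leif_AGM_scaled int _ predT E.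
    by move=> [] i _ /=; rewrite mulrn_wge0.
  rewrite big_sumType /= big_sumType /= !big_const_ord card_sum !card_ord => + _.
  rewrite !iter_mulr_1 !iter_addr_0 -!mulrnA -mulrnDr -!natrX -natrM ler_nat.
  have -> : b + c + b = 2 * b + c by lia.
  by rewrite expnMn -mulnA -expnD.
have -> : a ^ a * b ^ b * 4 ^ b = (2 ^ b * a ^ a) * (2 * b) ^ b.
  by rewrite expnMn (_ : 4 = 2 * 2) // expnMn; lia.
rewrite expnD; apply: leq_mul => //; apply: leq_expnl; lia.
Qed.

Lemma card_dep_pairs (T U : finType) (A : {set T}) (B : T -> {set U}) :
  #|[set p | (p.1 \in A) && (p.2 \in B p.1)]| = \sum_(a in A) #|B a|.
Proof.
rewrite -sum1dep_card -(pair_big_dep (mem A) (fun a u => u \in B a)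
  (fun _ _ => 1)) /=; apply: eq_bigr => a _; exact: sum1_card.
Qed.

(** * Bipartite subgraphs of large minimum degree *)

Section MinDegree.
Variables (T U : finType) (e : T -> U -> bool).

Definition edges (X : {set T}) (N : {set U}) : {set T * U} :=
  [set p | [&& p.1 \in X, p.2 \in N & e p.1 p.2]].

Lemma card_edges_delL (X : {set T}) (N : {set U}) x : x \in X ->
  #|edges X N| = #|[set v in N | e x v]| + #|edges (X :\ x) N|.
Proof.
move=> xX; rewrite -(@card_imset U (T * U)%type (pair x)); last by move=> u v /(congr1 snd).
rewrite -card_disjU.
  congr #|pred_of_set _|; apply/setP => -[y v]; rewrite !inE /=.
  have [->|yx] := eqVneq y x.
    rewrite xX /= orbF; apply/idP/imsetP => [xv|[w]].
      by exists v; rewrite // inE.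
    by rewrite inE => wN /(congr1 snd) /= ->.
  apply/idP/orP => [->|[/imsetP[w _ /(congr1 fst) /= xy]|//]]; first by right.
  by rewrite xy eqxx in yx.
apply/pred0P => -[y v] /=; apply/negbTE/negP => /andP[/imsetP[w _ [-> _]]].
by rewrite !inE eqxx.
Qed.

Lemma card_edges_delR (X : {set T}) (N : {set U}) v : v \in N ->
  #|edges X N| = #|[set x in X | e x v]| + #|edges X (N :\ v)|.
Proof.
move=> vN; rewrite -(@card_imset T (T * U)%type (fun x => (x, v))); last by move=> x y /(congr1 fst).
rewrite -card_disjU.
  congr #|pred_of_set _|; apply/setP => -[x w]; rewrite !inE /=.
  have [->|wv] := eqVneq w v.
    rewrite vN andbF orbF /=; apply/idP/imsetP => [xv|[y]].
      by exists x; rewrite // inE.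
    by rewrite inE => yX /(congr1 fst) /= ->.
  apply/idP/orP => [->|[/imsetP[y _ /(congr1 snd) /= xy]|//]]; first by right.
  by rewrite xy eqxx in wv.
apply/pred0P => -[x w] /=; apply/negbTE/negP => /andP[/imsetP[y _ [_ ->]]].
by rewrite !inE eqxx andbF.
Qed.

(** Vertices of degree at most [u] in [X] or at most [w] in [N] are deleted one at a time. Each
    deletion preserves the strict inequality, so some edge survives to the end. *)
Lemma min_degree_subgraph u w (X : {set T}) (N : {set U}) :
  u * #|X| + w * #|N| < #|edges X N| ->
  exists (X' : {set T}) (N' : {set U}), [/\ X' \subset X, X' != set0,
    forall x, x \in X' -> u < #|[set v in N' | e x v]| &
    forall v, v \in N' -> w < #|[set x in X' | e x v]|].
Proof.
move: {2}(#|X| + #|N|) (leqnn (#|X| + #|N|)) => k.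
elim: k X N => [|k IH] X N sz big.
  move: sz big; rewrite leqn0 addn_eq0 !cards_eq0 => /andP[/eqP -> /eqP ->].
  rewrite !cards0 !muln0 => /card_gt0P[p]; by rewrite !inE.
have [/existsP[x /andP[xX dx]]|goodX] :=
    boolP [exists x, (x \in X) && (#|[set v in N | e x v]| <= u)].
  have [||X' [N' [sX' X'0 dX' dN']]] := IH (X :\ x) N.
  - by move: sz; rewrite (cardsD1 x X) xX.
  - by move: big; rewrite (card_edges_delL _ xX) (cardsD1 x X) xX; lia.
  by exists X', N'; split=> //; apply: subset_trans sX' (subsetDl _ _).
have [/existsP[v /andP[vN dv]]|goodN] :=
    boolP [exists v, (v \in N) && (#|[set x in X | e x v]| <= w)].
  have [||X' [N' [sX' X'0 dX' dN']]] := IH X (N :\ v).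
  - by move: sz; rewrite (cardsD1 v N) vN; lia.
  - by move: big; rewrite (card_edges_delR _ vN) (cardsD1 v N) vN; lia.
  by exists X', N'; split.
exists X, N; split=> //.
- have /card_gt0P[p] : 0 < #|edges X N| by lia.
  by rewrite inE => /and3P[pX _ _]; apply/set0Pn; exists p.1.
- by move=> x xX; move/existsPn/(_ x): goodX; rewrite xX /= -ltnNge.
by move=> v vN; move/existsPn/(_ v): goodN; rewrite vN /= -ltnNge.
Qed.
End MinDegree.

(** * Isoperimetry and growth in a cube *)

Section Cube.
Variables (V : finZmodType) (r : nat) (b : 'I_r -> V) (phi : 'I_r -> V -> bool).
Hypothesis addvv : forall x : V, (x + x = 0)%R.
Hypothesis phib : forall i j x, phi i (x + b j)%R = phi i x (+) (i == j).

(** Induction on the directions. When [A] is split by the coordinate [phi i], edges in other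
    directions stay inside a half, ordered edges in direction [i] number at most twice the smaller
    half, and [entropy_expn] combines the bounds. The logarithm of the result is the usual
    edge-isoperimetric inequality. *)
Lemma edge_isoperimetry (A : {set V}) :
  2 ^ (\sum_(i < r) #|[set x in A | (x + b i)%R \in A]|) <= #|A| ^ #|A|.
Proof.
rewrite -big_enum /=; have := enum_uniq 'I_r; elim: (enum 'I_r) A => [|i s IH] A.
  move=> _; rewrite big_nil expn0; case: #|A| => // k; exact: expn_gt0.
case/andP => iNs us.
pose half c := [set x in A | phi i x == c].
have dh : [disjoint half true & half false].
  by rewrite -setI_eq0; apply/eqP/setP => x; rewrite !inE; case: (phi i x); rewrite ?andbF.
have Ah : half true :|: half false = A.
  by apply/setP => x; rewrite !inE; case: (phi i x); rewrite ?andbT ?andbF ?orbF.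
have split_j j : j \in s -> #|[set x in A | (x + b j)%R \in A]| =
   #|[set x in half true | (x + b j)%R \in half true]| +
   #|[set x in half false | (x + b j)%R \in half false]|.
  move=> js; have ij : (i == j) = false by apply/negbTE; apply: contraNneq iNs => ->.
  rewrite -card_disjU.
    congr #|pred_of_set _|; apply/setP => x; rewrite !inE phib ij addbF.
    by case: (phi i x); rewrite ?andbT ?andbF ?orbF.
  apply: disjointWl (disjointWr _ dh); first by apply/subsetP => x; rewrite inE => /andP[].
  by apply/subsetP => x; rewrite inE => /andP[].
have edge_i c : #|[set x in A | (x + b i)%R \in A]| <= 2 * #|half c|.
  rewrite -(cardsID (half c)) mul2n -addnn; apply: leq_add.
    by apply: subset_leq_card; rewrite subsetIr.
  rewrite -(card_imset _ (addIr (b i))); apply: subset_leq_card.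
  apply/subsetP => y /imsetP[x]; rewrite !inE => /andP[nh /andP[xA xbA]] ->.
  rewrite xbA phib eqxx; rewrite xA /= in nh; rewrite addbT.
  by case: (phi i x) nh; case: c.
rewrite big_cons expnD (eq_big_seq _ split_j) big_split /= expnD.
have leI c := leq_pexp2l (ltn0Sn 1) (edge_i c).
rewrite -[in X in _ <= X]Ah card_disjU //.
have IHt := IH (half true) us; have IHf := IH (half false) us.
case: (leqP #|half false| #|half true|) => [le|/ltnW le].
  apply: leq_trans (entropy_expn le).
  rewrite mulnC; apply: leq_mul; first exact: leq_mul.
  by apply: leq_trans (leI false) _; rewrite expnM.
rewrite [#|half true| + _]addnC; apply: leq_trans (entropy_expn le).
rewrite mulnC [X in X * _ <= _]mulnC; apply: leq_mul; first exact: leq_mul.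
by apply: leq_trans (leI true) _; rewrite expnM.
Qed.

Definition corner (x : V) (Z : {set 'I_r}) : V := (x + \sum_(i in Z) b i)%R.

Lemma corner_inj x : injective (corner x).
Proof.
have par i (s : seq 'I_r) : uniq s ->
    phi i (x + \sum_(j <- s) b j)%R = phi i x (+) (i \in s).
  elim: s => [_|j s IH /= /andP[js us]]; first by rewrite big_nil addr0 addbF.
  rewrite big_cons addrCA addrC phib IH // inE -addbA; congr (_ (+) _).
  by have [->|] := eqVneq i j; rewrite ?addbF // (negbTE js).
move=> Y Z eYZ; apply/setP => i; have := congr1 (phi i) eYZ.
rewrite /corner -!big_enum /= !par ?enum_uniq // !mem_enum.
exact: addbI.
Qed.

(* In a subgraph of large minimum degree, from any vertex one can climb along
   [J] fresh directions and come back down along [J] others: this produces many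
   corners inside [X]. *)
Lemma boundary_growth (X N : {set V}) (u w J c : nat) :
  (forall x i, x \in X -> (x + b i)%R \in N) ->
  u * #|X| + w * #|N| < r * #|X| -> 0 < J -> 2 * J <= w ->
  c * (2 * J) ^ 2 + 2 * J <= u -> c ^ J <= #|X|.
Proof.
move=> bXN big J0 Jw cu.
have b_inj : injective b.
  move=> i j ij; have := phib i i 0%R; rewrite ij phib eqxx => /addbI.
  by case: eqVneq.
pose e (x v : V) := [exists i, v == (x + b i)%R].
have card_dir x (M : {set V}) :
    #|[set v in M | e x v]| <= #|[set i | (x + b i)%R \in M]|.
  rewrite -(card_imset _ (fun i j => @b_inj i j \o @addrI _ x (b i) (b j))).
  apply: subset_leq_card; apply/subsetP => v; rewrite inE => /andP[vM /existsP[i /eqP vi]].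
  by apply/imsetP; exists i; rewrite ?inE -?vi.
have [|X' [N' [sX' X'0 dX dN]]] := @min_degree_subgraph V V e u w X N.
  apply: leq_trans big _; rewrite -[r]card_ord -cardsT mulnC -cardsX.
  rewrite -(@card_imset _ _ (fun p => (p.1, p.1 + b p.2)%R)).
    apply: subset_leq_card; apply/subsetP => q /imsetP[[x i]]; rewrite !inE /= andbT.
    by move=> xX ->; rewrite /= xX bXN //=; apply/existsP; exists i.
  move=> [x i] [y j] /= xy; have e1 : x = y := congr1 fst xy.
  have e2 : (x + b i = y + b j)%R := congr1 snd xy.
  subst y.
  by congr pair; apply: b_inj; apply: (@addrI _ x).
have [x0 x0X'] := set0Pn _ X'0.
pose L j := [set Z : {set 'I_r} | (#|Z| == 2 * j) && (corner x0 Z \in X')].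
have LX j : #|L j| <= #|X|.
  rewrite -(card_imset _ (@corner_inj x0)); apply: subset_leq_card.
  by apply/subsetP => x /imsetP[Z]; rewrite inE => /andP[_ /(subsetP sX') ? ->].
(* Double counting: from a corner in [L j] there are at least [u - 2 * j] fresh directions up to
   [N'], each followed by a fresh direction down to [X']. The new set and the two directions
   determine the old set, and a set of [2 * j.+1] directions contains [(2 * j.+1) ^ 2] ordered
   pairs. *)
have step j : j < J -> c * #|L j| <= #|L j.+1|.
  move=> jJ.
  pose up (Z : {set 'I_r}) := [set i | (corner x0 Z + b i)%R \in N'] :\: Z.
  pose P := [set q : {set 'I_r} * 'I_r | (q.1 \in L j) && (q.2 \in up q.1)].
  pose Q := [set t : {set 'I_r} * ('I_r * 'I_r) |
               (t.1 \in L j.+1) && (t.2 \in setX t.1 t.1)].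
  pose down (q : {set 'I_r} * 'I_r) (k : 'I_r) := [&& k \notin q.1, k != q.2 &
     (corner x0 q.1 + b q.2 + b k)%R \in X'].
  pose dn q := odflt q.2 [pick k | down q k].
  have downP q : q \in P -> down q (dn q).
    rewrite !inE => /andP[/andP[/eqP cZ _] /andP[iZ iN]].
    rewrite /dn; case: pickP => //= none.
    (* Without a fresh way down, the more than [w] neighbours in [X'] would all use the [2 * j + 1]
       directions already present, fewer than [w]. *)
    suff : w < #|q.2 |: q.1| by rewrite cardsU1 iZ cZ; lia.
    apply: leq_trans (dN _ iN) _.
    apply: leq_trans (leq_imset_card
      (fun k => corner x0 q.1 + b q.2 + b k)%R (mem (q.2 |: q.1))).
    apply: subset_leq_card; apply/subsetP => x.
    rewrite inE => /andP[xX' /existsP[k /eqP ex]].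
    have xk : (x = corner x0 q.1 + b q.2 + b k)%R by rewrite ex -addrA addvv addr0.
    rewrite xk; apply: imset_f; move: (none k); rewrite /down -xk xX' andbT.
    by rewrite in_setU1; case: (k \in q.1); rewrite ?orbT //= => /negbFE ->.
  have cornerU1 i (Z : {set 'I_r}) : i \notin Z ->
      corner x0 (i |: Z) = (corner x0 Z + b i)%R.
    by move=> iZ; rewrite /corner big_setU1 //= addrCA addrC.
  pose g (q : {set 'I_r} * 'I_r) := (dn q |: (q.2 |: q.1), (q.2, dn q)).
  have freshP q : q \in P -> (q.2 \notin q.1) && (dn q \notin q.2 |: q.1).
    move=> qP; have /and3P[kZ ki _] := downP q qP.
    rewrite !inE negb_or ki kZ; move: qP; rewrite !inE.
    by move=> /andP[_ /andP[-> _]].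
  have gQ : [set g q | q in P] \subset Q.
    apply/subsetP => t /imsetP[q qP ->]; have /andP[iZ kiZ] := freshP q qP.
    have /and3P[_ _ kX'] := downP q qP; move: qP; rewrite !inE /=.
    move=> /andP[/andP[/eqP cZ _] _].
    rewrite !cardsU1 iZ kiZ cZ !cornerU1 // kX' !eqxx !orbT !andbT.
    by apply/eqP; lia.
  have g_inj : {in P &, injective g}.
    move=> [Z i] [Z' i'] qP qP' /= e12.
    have /andP[/= iZ kiZ] := freshP _ qP; have /andP[/= iZ' kiZ'] := freshP _ qP'.
    have e1 : dn (Z, i) |: (i |: Z) = dn (Z', i') |: (i' |: Z') := congr1 fst e12.
    have e2 : i = i' := congr1 (fst \o snd) e12.
    have e3 : dn (Z, i) = dn (Z', i') := congr1 (snd \o snd) e12.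
    congr pair => //; rewrite -(setU1K iZ) -(setU1K kiZ) e1 e3 e2.
    by rewrite !setU1K.
  have cQ : #|Q| = #|L j.+1| * (2 * j.+1) ^ 2.
    rewrite (card_dep_pairs _ (fun Z => setX Z Z)) -sum_nat_const.
    apply: eq_bigr => Z.
    by rewrite inE cardsX => /andP[/eqP -> _]; rewrite -mulnn.
  have cP : #|L j| * (u - 2 * j) <= #|P|.
    rewrite card_dep_pairs -sum_nat_const; apply: leq_sum => Z.
    rewrite inE => /andP[/eqP cZ xX']; rewrite cardsD leq_sub //.
      by apply: leq_trans (card_dir _ _); apply: ltnW; apply: dX.
    by rewrite -cZ subset_leq_card // subsetIr.
  have := subset_leq_card gQ; rewrite card_in_imset // cQ => cPQ.
  have s0 : 0 < (2 * J) ^ 2 by rewrite expn_gt0 muln_gt0 J0.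
  rewrite -(leq_pmul2r s0); apply: leq_trans (_ : #|L j.+1| * (2 * j.+1) ^ 2 <= _).
    apply: leq_trans (leq_trans cP cPQ).
    by rewrite mulnAC mulnC leq_mul2l; apply/orP; right; lia.
  by rewrite leq_mul2l leq_expnl ?orbT // leq_mul2l jJ orbT.
have grow j : j <= J -> c ^ j <= #|L j|.
  elim: j => [_|j IH jJ].
    rewrite expn0 card_gt0; apply/set0Pn; exists set0.
    by rewrite !inE cards0 /corner big_set0 addr0.
  by rewrite expnS; apply: leq_trans (step _ jJ); rewrite leq_mul2l IH ?orbT // ltnW.
exact: leq_trans (grow J (leqnn J)) (LX J).
Qed.
End Cube.

Lemma subset_of_card (T : finType) (A : {set T}) k :
  k <= #|A| -> exists2 S : {set T}, S \subset A & #|S| = k.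
Proof.
move=> kA; exists [set x in take k (enum A)].
  by apply/subsetP => x; rewrite inE => /mem_take; rewrite mem_enum.
rewrite cardsE (card_uniqP _) ?take_uniq ?enum_uniq // size_take -cardE.
by case: ltngtP kA.
Qed.

(** * Small subsets with many sums, and covers of the popular sums *)

Section Growth.
Variable V : finZmodType.
Hypothesis addvv : forall x : V, (x + x = 0)%R.

(** A set [S] of [a] elements of degree at least [a] in [E] carries [a * a] pairs. If the greedy [T]
    stops with fewer than [G] sums, at most [#|X| * theta] of these pairs have their sum outside
    [sumset T S] and at most [G * tau] inside, which is too few. *)
Lemma unpopular_growth (X : {set V}) (E : {set V * V}) tau theta a k G :
  0 < #|X| -> E \subset setX X X ->
  (forall s, #|[set p in E | (p.1 + p.2)%R == s]| <= tau) ->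
  2 * a * #|X| <= #|E| -> G <= k * theta -> #|X| * theta + G * tau < a * a ->
  exists S T : {set V}, [/\ S \subset X, T \subset X, #|S| <= a, #|T| <= k &
    G <= #|sumset T S|].
Proof.
move=> X0 sE mE cE Gk small.
have swap_inj : injective (fun p : V * V => (p.2, p.1)).
  by move=> [c d] [c' d'] /= [-> ->].
pose deg y := #|[set x in X | (x, y) \in E]|.
pose S0 := [set y in X | a <= deg y].
have aS0 : a <= #|S0|.
  have : #|E| <= #|S0| * #|X| + #|X| * a.
    have -> : #|E| = \sum_(y in X) deg y.
      rewrite -card_dep_pairs -[LHS](card_imset _ swap_inj).
      congr #|pred_of_set _|; apply/setP => -[y x]; rewrite !inE /=.
      apply/imsetP/idP => [[[c d] cdE [-> ->]]|/and3P[yX xX xyE]].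
        by have := subsetP sE _ cdE; rewrite in_setX cdE => /andP[-> ->].
      by exists (x, y).
    rewrite (bigID (mem S0)) /=; apply: leq_add.
      apply: leq_trans (_ : \sum_(y in S0) deg y <= _).
        rewrite [X in _ <= X](eq_bigl (fun y => (y \in X) && (y \in S0))) // => y.
        by rewrite !inE; case: (y \in X).
      rewrite -sum_nat_const.
      by apply: leq_sum => y _; apply: subset_leq_card; apply/subsetP => x; rewrite inE => /andP[].
    rewrite -[X in _ <= X]sum_nat_const big_mkcondr; apply: leq_sum => y yX.
    by rewrite inE yX; case: (leqP a (deg y)) => // /ltnW.
  nia.
have [S sS cS] := subset_of_card aS0.
have sSX : S \subset X by apply: subset_trans sS _; apply/subsetP => y; rewrite inE => /andP[].
have [T [sT cT gain]] := greedy_sumset X S theta k.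
exists S, T; split=> //; first by rewrite cS.
case: gain => [gain|closed]; first exact: leq_trans gain.
rewrite leqNgt; apply/negP => fewW; set W := sumset T S in fewW closed.
pose Q := [set p in E | p.2 \in S].
have aQ : a * a <= #|Q|.
  have -> : #|Q| = \sum_(y in S) deg y.
    rewrite -card_dep_pairs -[LHS](card_imset _ swap_inj).
    congr #|pred_of_set _|; apply/setP => -[y x]; rewrite !inE /=.
    apply/imsetP/idP => [[[c d]]|/and3P[yS xX xyE]].
      rewrite inE /= => /andP[cdE dS] [-> ->].
      by have := subsetP sE _ cdE; rewrite in_setX cdE dS => /andP[-> _].
    by exists (x, y); rewrite // inE xyE.
  rewrite -{1}cS -sum_nat_const; apply: leq_sum => y /(subsetP sS).
  by rewrite inE => /andP[].
have : #|Q| <= #|X| * theta + #|W| * tau.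
  rewrite -(cardsID [set p : V * V | (p.1 + p.2)%R \notin W] Q); apply: leq_add.
    apply: leq_trans (_ : \sum_(x in X) #|[set y in S | (x + y)%R \notin W]| <= _).
      rewrite -card_dep_pairs; apply: subset_leq_card; apply/subsetP => -[x y].
      rewrite !inE /= => /andP[/andP[xyE ->] ->]; rewrite !andbT.
      by have := subsetP sE _ xyE; rewrite in_setX => /andP[].
    rewrite -sum_nat_const; apply: leq_sum => x xX.
    apply: leq_trans (ltnW (closed x xX)).
    rewrite -(card_imset _ (addrI x)); apply: subset_leq_card.
    apply/subsetP => v /imsetP[y]; rewrite inE => /andP[yS xyW] ->.
    by rewrite inE xyW imset_f.
  apply: leq_trans (_ : #|\bigcup_(s in W) [set p in E | (p.1 + p.2)%R == s]| <= _).
    apply: subset_leq_card; apply/subsetP => p; rewrite !inE negbK.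
    by move=> /andP[pW /andP[pE _]]; apply/bigcupP; exists (p.1 + p.2)%R; rewrite // inE pE eqxx.
  apply: leq_trans (leq_card_bigcup _ _) _.
  by rewrite -sum_nat_const; apply: leq_sum => s _.
by move: fewW; nia.
Qed.

(** A first set [S] meets every [reps X s] in at least [k] points. Translated by [s], these
    intersections are subsets of [X] of size at least [k], so a small second set [T] hits them all;
    a hit [s + x] writes [s] as the sum of [s + x] in [T] and [x] in [S]. *)
Lemma popular_cover (X F : {set V}) c t k c' :
  0 < #|X| -> (forall s, s \in F -> #|X| <= c * (#|reps X s| - k * (c * t))) ->
  #|F| < 2 ^ t -> #|X| <= c' * k ->
  exists S T : {set V}, [/\ S \subset X, T \subset X, #|S| <= k * (c * t),
    #|T| <= c' * t & F \subset sumset T S].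
Proof.
move=> X0 cD cF cX.
have sub s : reps X s \subset X by apply/subsetP => x; rewrite inE => /andP[].
have [S [sSX cS kS]] := multi_hitting_set X0 (fun s _ => sub s) cD cF.
have [|s sF||T [sTX cT hT]] :=
    @hitting_set V V F (fun s => translate s (S :&: reps X s)) X c' t X0.
- move=> s _; apply/subsetP => v /imsetP[x]; rewrite !inE => /and3P[_ _ xsX] ->.
  by rewrite addrC.
- by apply: leq_trans cX _; rewrite card_translate leq_mul2l kS ?orbT.
- by [].
exists S, T; split=> //; apply/subsetP => s sF.
have /card_gt0P[v] := hT s sF; rewrite inE => /andP[vT /imsetP[x]].
rewrite inE => /andP[xS _] vx; apply/imset2P; exists v x => //.
by rewrite vx -addrA addvv addr0.
Qed.

(** Edge-isoperimetry for [F :|: X]: in each direction [b i] all but [h] elements of [X] have their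
    neighbour in [F]. As 0 is in [X], at most [h] elements of [X] lie outside [F]. *)
Lemma popular_isoperimetry r (b : 'I_r -> V) (phi : 'I_r -> V -> bool)
    (X F : {set V}) h :
  (forall i j x, phi i (x + b j)%R = phi i x (+) (i == j)) ->
  (forall i, b i \in X) -> 0%R \in X ->
  (forall x, x \in X -> #|[set y in X | (x + y)%R \notin F]| <= h) ->
  exists2 M, M <= #|F| + h & 2 ^ (r * (#|X| - h)) <= M ^ M.
Proof.
move=> phib bX X0 good; exists #|F :|: X|.
  have -> : F :|: X = F :|: [set y in X | (0 + y)%R \notin F].
    by apply/setP => y; rewrite !inE add0r; case: (y \in F); rewrite ?andbT.
  by apply: leq_trans (leq_card_setU _ _) _; rewrite leq_add2l good.
apply: leq_trans (edge_isoperimetry phib (F :|: X)).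
rewrite leq_exp2l // -[r in r * _]card_ord -sum_nat_const; apply: leq_sum => i _.
rewrite leq_subLR.
apply: leq_trans (subset_leq_card (_ : X \subset [set y in X | (b i + y)%R \notin F] :|:
    [set x in F :|: X | (x + b i)%R \in F :|: X])) _.
  apply/subsetP => x xX; rewrite !inE xX addrC orbT.
  by case: (_ \in F).
by apply: leq_trans (leq_card_setU _ _) _; rewrite leq_add2r good.
Qed.
End Growth.

(** * Short certificates *)

Section RowVectors.
Variable n : nat.
Local Notation V := 'rV['F_2]_n.

Lemma F2_addrr (x : 'F_2) : (x + x = 0)%R.
Proof. by case: x => -[|[|]] //= ?; apply/val_inj. Qed.

Lemma mxF2_addrr p q (x : 'M['F_2]_(p, q)) : (x + x = 0)%R.
Proof. by apply/matrixP => i j; rewrite !mxE F2_addrr. Qed.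

(** A maximal independent family of elements of [X]; the right inverse [C] gives the dual
    coordinates. Drawing the basis from [X] puts the neighbours of [X] in the cube into
    [sumset X X]. *)
Lemma basis_of_set (X : {set V}) :
  exists r (B : 'M['F_2]_(r, n)) (C : 'M['F_2]_(n, r)),
    [/\ (B *m C = 1%:M)%R, forall i, row i B \in X &
     forall x, x \in X -> (x <= B)%MS].
Proof.
pose M := (\matrix_(i < #|X|) enum_val i : 'M['F_2]_(#|X|, n))%R.
exists (\rank M), (rowsub (maxrankfun M) M).
have /row_freeP[C BC] := maxrowsub_free M; exists C; split=> //.
  by move=> i; rewrite row_rowsub rowK; apply: enum_valP.
move=> x xX; rewrite eq_maxrowsub.
have <- : row (enum_rank_in xX x) M = x by rewrite rowK enum_rankK_in.
exact: row_sub.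
Qed.

Definition coord r (C : 'M['F_2]_(n, r)) (i : 'I_r) (x : V) : bool :=
  ((x *m C)%R ord0 i == 1%R).

Lemma coordD r (B : 'M['F_2]_(r, n)) (C : 'M['F_2]_(n, r)) :
  (B *m C = 1%:M)%R ->
  forall i j x, coord C i (x + row j B)%R = coord C i x (+) (i == j).
Proof.
move=> BC i j x; rewrite /coord mulmxDl -row_mul BC !mxE [j == i]eq_sym.
move: (\sum_j _)%R => a; case: (i == j); rewrite ?addbF ?addr0 ?addbT //.
by case: a => -[|[|]].
Qed.

Lemma card_rowspace r (B : 'M['F_2]_(r, n)) (X : {set V}) :
  (forall x, x \in X -> (x <= B)%MS) -> #|X| <= 2 ^ r.
Proof.
move=> sX; have -> : 2 ^ r = #|{: 'rV['F_2]_r}| by rewrite card_mx card_Fp ?mul1n.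
apply: leq_trans (leq_imset_card (fun y : 'rV['F_2]_r => y *m B)%R predT).
apply: subset_leq_card; apply/subsetP => x /sX /submxP[y ->].
exact: imset_f.
Qed.

Lemma rank_dual r (B : 'M['F_2]_(r, n)) (C : 'M['F_2]_(n, r)) :
  (B *m C = 1%:M)%R -> \rank B = r.
Proof. by move=> BC; apply/eqP; apply/row_freeP; exists C. Qed.

(** What a clique forces into the random set; 0 is left out because distinct vertices never sum to
    it. *)
Definition nz_sums (S : {set V}) : {set V} := sumset S S :\ 0%R.

Lemma card_nz_sums (S : {set V}) : #|sumset S S| <= #|nz_sums S|.+1.
Proof. by rewrite (cardsD1 0%R (sumset S S)); case: (_ \in _); rewrite ?add1n. Qed.

Lemma nz_sumsS (S T : {set V}) : S \subset T -> nz_sums S \subset nz_sums T.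
Proof. by move=> sST; apply/setSD/sumsetS. Qed.

Lemma nz_sums_translate x (S : {set V}) : nz_sums (translate x S) = nz_sums S.
Proof.
congr (_ :\ _); rewrite /sumset; apply/setP => v.
apply/imset2P/imset2P => -[a b].
  move=> /imsetP[c cS ->] /imsetP[d dS ->] ->; exists c d => //.
  by rewrite addrACA mxF2_addrr add0r.
move=> aS bS ->; exists (x + a)%R (x + b)%R; rewrite ?imset_f //.
by rewrite addrACA mxF2_addrr add0r.
Qed.

(* [B] costs [r * n] bits and the coordinates of the at most [q] elements of [Y]
   cost [q * r] bits; the excess [4 * l] pays for the sum over [r] and [q]. *)
Definition basis_certificate (l : nat) (X : {set V}) : Prop :=
  exists r q (B : 'M['F_2]_(r, n)) (Y : {set V}),
    [/\ r <= n, q <= 11 * n, nz_sums Y \subset nz_sums X, (forall y, y \in Y -> (y <= B)%MS) &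
        #|Y| <= q /\ r * n + q * r + 4 * l <= #|nz_sums Y|].

Definition container (Y T : {set V}) : {set V} :=
  [set g | #|translate g Y :\: sumset T Y| < 2 * n].

(** Of the [13 * r * n] sums, [11 * r * n] pay for [B], [Y] and [T], another [r * n] for the
    positions of the elements of [X] in the container, and the last [r * n] for the slack in the
    union bound. *)
Definition container_certificate (R : nat) (X : {set V}) : Prop :=
  exists r (B : 'M['F_2]_(r, n)) (Y T : {set V}),
    [/\ R < r <= n, (forall y, y \in Y -> (y <= B)%MS),
        (forall y, y \in T -> (y <= B)%MS), #|Y| = 4 * n /\ #|T| <= 6 * r &
        X \subset container Y T /\ 13 * r * n <= #|nz_sums X|].

(** The two outcomes of [popular_core]. If at least [h] elements are discarded, the recorded pairs
    feed [unpopular_growth]. Otherwise the popular sums of the core are cheap by [popular_cover] and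
    many by [popular_isoperimetry]; the last hypothesis compares the two numerically. *)
Lemma low_rank_certificate (l m h tau theta R c t k c' : nat) (X : {set V})
    r0 (B0 : 'M['F_2]_(r0, n)) :
  #|X| = m -> (forall x, x \in X -> (x <= B0)%MS) -> r0 <= n -> r0 <= R ->
  1 < m -> h < m -> 2 * n * m <= h * h -> 0 < tau ->
  4 * R <= theta -> m * theta + 4 * n * R * tau < n * n -> 5 * l < n ->
  m <= c * (tau - k * (c * t)) -> m * m < 2 ^ t -> m <= c' * k ->
  k * (c * t) + c' * t <= n ->
  (forall r M, r <= R -> m - h <= 2 ^ r -> 2 ^ (r * (m - h - h)) <= M ^ M ->
     r * n + (k * (c * t) + c' * t) * r + 4 * l + h + 1 <= M) ->
  basis_certificate l X.
Proof.
move=> cX sB0 r0n r0R m1 hm hh tau0 Rtheta small ln mc mt mc' qn growth.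
have r00 : 0 < r0.
  rewrite lt0n; apply/eqP => r0E; move: (card_rowspace sB0); rewrite cX r0E.
  by rewrite expn0 leqNgt m1.
have addvv := @mxF2_addrr 1 n.
have [X' [E [sX'X sE cE mE good]]] := popular_core addvv tau h X.
have [big|few] := leqP h #|X :\: X'|.
  (* Two subsets of at most [n] elements, with the basis, cost [3 * n * r0] bits and have
     [4 * n * r0] sums; the difference pays for [4 * l]. *)
  have [||||S [T [sS sT cS cT gain]]] :=
    @unpopular_growth _ X E tau theta n n (4 * n * r0) _ sE mE.
  - by rewrite cX; lia.
  - by rewrite cX; apply: leq_trans hh (leq_trans _ cE); rewrite leq_mul2l big orbT.
  - by nia.
  - by rewrite cX; nia.
  exists r0, (2 * n), B0, (S :|: T); split=> //; first by lia.
  - by apply: nz_sumsS; rewrite subUset sS.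
  - by move=> y; rewrite inE => /orP[/(subsetP sS)|/(subsetP sT)]; apply: sB0.
  split.
    by apply: leq_trans (leq_card_setU _ _) (leq_trans (leq_add cS cT) _); lia.
  have := subset_leq_card (sumsetS (subsetUr S T) (subsetUl S T)).
  have := leq_pmulr n r00; have := card_nz_sums (S :|: T); lia.
have cX' : m - h <= #|X'|.
  rewrite leq_subLR addnC -leq_subLR; apply: ltnW.
  by move: few; rewrite cardsD (setIidPr sX'X) cX.
have [x0 x0X'] : exists x0, x0 \in X' 
  by apply/card_gt0P; apply: leq_trans cX'; rewrite subn_gt0.
pose X2 := translate x0 X'.
have X20 : 0%R \in X2 by rewrite mem_translate // addr0.
have cX2 : #|X2| = #|X'| by apply: card_translate.
have [r [B [C [BC BX2 X2B]]]] := basis_of_set X2.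
have sB0' x : x \in X2 -> (x <= B0)%MS.
  rewrite mem_translate // => /(subsetP sX'X)/sB0 xx0.
  rewrite -[x](addvK addvv x0) addmx_sub // sB0 //; exact: (subsetP sX'X).
have rr0 : r <= r0.
  rewrite -(rank_dual BC); apply: leq_trans (rank_leq_row B0); apply: mxrankS.
  by apply/row_subP => i; apply: sB0'.
pose F := [set s | tau <= #|reps X2 s|].
have reps2 s : #|reps X2 s| = #|reps X' s|.
  rewrite -[RHS](card_translate x0); congr #|pred_of_set _|.
  by apply/setP => x; rewrite !(inE, mem_translate) // addrA.
have good2 x : x \in X2 -> #|[set y in X2 | (x + y)%R \notin F]| <= h.
  rewrite mem_translate // => xX'; apply: leq_trans (ltnW (good _ xX')).
  rewrite -[X in _ <= X](card_translate x0); apply: subset_leq_card.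
  apply/subsetP => y; rewrite !(inE, mem_translate) // => /andP[-> /=].
  by rewrite -ltnNge reps2 addrACA addvv add0r.
have [M MF iso] := @popular_isoperimetry V r (fun i => row i B) (coord C) X2 F h
  (coordD BC) BX2 X20 good2.
have c_t : #|F| < 2 ^ t.
  apply: leq_ltn_trans mt; apply: leq_trans (_ : #|X2| * #|X2| <= _).
    apply: leq_trans (card_sumset _ _); apply: subset_leq_card.
    apply/subsetP => s; rewrite inE => sF.
    have /card_gt0P[x] : 0 < #|reps X2 s| by lia.
    rewrite inE => /andP[xX xsX]; apply/imset2P; exists x (x + s)%R => //.
    by rewrite addvK.
  by have := subset_leq_card sX'X; rewrite cX2 cX; nia.
have [|s||S [T [sS sT cS cT FST]]] := @popular_cover _ addvv X2 F c t k c' _ _ c_t.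
- by apply/card_gt0P; exists 0%R.
- rewrite inE cX2 => sF; have := subset_leq_card sX'X; rewrite cX => cX'm.
  by apply: leq_trans cX'm (leq_trans mc _); rewrite leq_mul2l leq_sub2r ?orbT.
- by have := subset_leq_card sX'X; rewrite cX2 cX; lia.
exists r, (k * (c * t) + c' * t), B, (S :|: T); split.
- exact: leq_trans rr0 r0n.
- exact: leq_trans qn (leq_pmull _ _).
- rewrite -(nz_sums_translate x0 X); apply: nz_sumsS; rewrite subUset.
  by rewrite (subset_trans sS) ?(subset_trans sT) ?imsetS.
- by move=> y; rewrite inE => /orP[/(subsetP sS)|/(subsetP sT)]; apply: X2B.
split; first by apply: leq_trans (leq_card_setU _ _) (leq_add cS cT).
have FZ := subset_leq_card (subset_trans FST (sumsetS (subsetUr S T) (subsetUl S T))).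
have FN := leq_trans FZ (card_nz_sums (S :|: T)).
have gM : r * n + (k * (c * t) + c' * t) * r + 4 * l + h + 1 <= M.
  apply: growth; [exact: leq_trans rr0 r0R | |].
    by apply: leq_trans cX' _; rewrite -cX2; apply: card_rowspace X2B.
  apply: leq_trans iso; rewrite leq_exp2l // leq_mul2l cX2; apply/orP; right.
  exact: leq_sub2r.
rewrite -ltnS; apply: leq_trans FN; rewrite -(leq_add2r h); apply: leq_trans MF.
by apply: leq_trans gM; rewrite -addn1 -!addnA [1 + h]addnC.
Qed.

(** If the greedy process from [4 * n] elements succeeds, its [12 * r * n] sums outweigh the cost
    [11 * r * n + 4 * l]. Otherwise [X] lies in the container, and with fewer than [13 * r * n] sums
    [boundary_growth] would give [c ^ J <= #|X|]. *)
Lemma high_rank_certificate (l m R w J c : nat) (X : {set V})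
    r (B : 'M['F_2]_(r, n)) (C : 'M['F_2]_(n, r)) :
  #|X| = m -> (B *m C = 1%:M)%R -> (forall i, row i B \in X) ->
  (forall x, x \in X -> (x <= B)%MS) -> R < r <= n ->
  4 * n <= m -> 4 * l < n -> 26 * w * n < m -> 0 < J -> 2 * J <= w ->
  c * (2 * J) ^ 2 + 2 * J <= R %/ 2 -> m < c ^ J ->
  basis_certificate l X \/ container_certificate R X.
Proof.
move=> cX BC BX XB /andP[Rr rn] nm ln wm J0 Jw cR mc.
have addvv := @mxF2_addrr 1 n.
have [Y sY cY] := @subset_of_card _ X (4 * n) ltac:(by rewrite cX).
have [T [sT cT [gain|closed]]] := greedy_sumset X Y (2 * n) (6 * r).
  left; exists r, (10 * n), B, (Y :|: T); split=> //.
  - by lia.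
  - by apply: nz_sumsS; rewrite subUset sY.
  - by move=> y; rewrite inE => /orP[/(subsetP sY)|/(subsetP sT)]; apply: XB.
  split.
    apply: leq_trans (leq_card_setU _ _) _; apply: leq_trans (_ : 4 * n + 6 * r <= _).
      by rewrite -cY leq_add2l.
    by lia.
  have := subset_leq_card (sumsetS (subsetUr Y T) (subsetUl Y T)).
  by have := card_nz_sums (Y :|: T); nia.
right; exists r, B, Y, T; split=> //; first by rewrite Rr.
- by move=> y /(subsetP sY); apply: XB.
- by move=> y /(subsetP sT); apply: XB.
split; first by apply/subsetP => x xX; rewrite inE closed.
rewrite leqNgt; apply/negP => few.
have cN : #|sumset X X| <= 13 * r * n by have := card_nz_sums X; lia.
have : c ^ J <= #|X|.
  apply: (@boundary_growth V r (fun i => row i B) (coord C) addvv (coordD BC)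
            X (sumset X X) (r %/ 2) w J c) => //.
  - by move=> x i xX; apply: imset2_f.
  - rewrite cX; have r0 : 0 < r by apply: leq_trans Rr.
    have half : r %/ 2 * 2 * m <= r * m by rewrite leq_mul2r leq_trunc_div orbT.
    have wN : w * #|sumset X X| <= w * (13 * r * n) by rewrite leq_mul2l cN orbT.
    have : r * (26 * w * n) < r * m by rewrite ltn_pmul2l.
    by move: half wN; move: (#|_|) (_ %/ 2) => N u; clear; lia.
  - by apply: leq_trans cR _; apply: leq_div2r; apply: ltnW.
by rewrite cX leqNgt mc.
Qed.
End RowVectors.

(** * Union bound *)

Lemma card_supersets (T : finType) (W : {set T}) :
  #|[set A : {set T} | W \subset A]| * 2 ^ #|W| = 2 ^ #|T|.
Proof.
have inj : {in [set A : {set T} | W \subset A] &, injective (fun A => A :\: W)}.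
  move=> A1 A2; rewrite !inE => s1 s2 e.
  by rewrite -(setID A1 W) -(setID A2 W) (setIidPr s1) (setIidPr s2) e.
rewrite -(card_in_imset inj) (_ : [set _ | _ in _] = powerset (~: W)).
  by rewrite card_powerset -expnD -(cardsC W) addnC.
apply/setP => A; rewrite inE; apply/imsetP/idP => [[A1 _ ->]|sA].
  by rewrite setDE subsetIr.
exists (A :|: W); first by rewrite inE subsetUr.
rewrite setDUl setDv setU0; apply/esym/setDidPl.
by rewrite disjoints_subset.
Qed.

Lemma union_bound (I T : finType) (W : I -> {set T}) (g : nat) (Q : pred {set T}) :
  (forall A, Q A -> exists2 c, g <= #|W c| & W c \subset A) ->
  #|[set A | Q A]| * 2 ^ g <= #|I| * 2 ^ #|T|.
Proof.
move=> QW.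
have sub : [set A | Q A] \subset
    \bigcup_(c | g <= #|W c|) [set A : {set T} | W c \subset A].
  apply/subsetP => A; rewrite inE => /QW[c gc sA].
  by apply/bigcupP; exists c; rewrite ?inE.
apply: leq_trans (leq_mul (subset_leq_card sub) (leqnn _)) _.
apply: leq_trans (leq_mul (leq_card_bigcup _ _) (leqnn _)) _.
rewrite big_distrl -[#|I|]sum1_card big_distrl /=.
rewrite big_mkcond; apply: leq_sum => c _; case: ifP => // gc.
by rewrite mul1n -(card_supersets (W c)) leq_mul2l leq_pexp2l ?orbT.
Qed.

Section UnionBound.
Variable n : nat.
Local Notation V := 'rV['F_2]_n.

Definition rowset q (D : 'M['F_2]_(q, n)) : {set V} := [set row i D | i in 'I_q].

Lemma rowset_code q r (B : 'M['F_2]_(r, n)) (Y : {set V}) :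
  Y != set0 -> #|Y| <= q -> (forall y, y \in Y -> (y <= B)%MS) ->
  exists D : 'M['F_2]_(q, r), rowset (D *m B)%R = Y.
Proof.
case/set0Pn => y0 y0Y Yq YB.
(* Rows beyond the last element of [Y] repeat the default [y0]. *)
exists (\matrix_(i < q) (nth y0 (enum Y) i *m pinvmx B))%R.
have nthY i : nth y0 (enum Y) i \in Y.
  have [lt|ge] := ltnP i (size (enum Y)); last by rewrite nth_default.
  by rewrite -mem_enum mem_nth.
have rowE (i : 'I_q) : (row i ((\matrix_(i < q) (nth y0 (enum Y) i *m pinvmx B)) *m B)
    = nth y0 (enum Y) i)%R.
  by rewrite row_mul rowK mulmxKpV // YB.
apply/setP => y; apply/imsetP/idP => [[i _ ->]|yY]; first by rewrite rowE.
have lt : index y (enum Y) < q.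
  by apply: leq_trans Yq; rewrite cardE index_mem mem_enum.
by exists (Ordinal lt); rewrite // rowE /= nth_index // mem_enum.
Qed.

(** Double counting with [W = sumset T Y]: every translate of [Y] by an element of the container has
    at least [2 * n] points in [W], and these incidences inject into [setX W Y], where [W] has at
    most [24 * r * n] elements. *)
Lemma card_container (Y T : {set V}) r :
  0 < n -> #|Y| = 4 * n -> #|T| <= 6 * r -> #|container Y T| <= 48 * (n * r).
Proof.
move=> n0 cY cT; rewrite -(@leq_pmul2r (2 * n)) ?muln_gt0 //.
set W := sumset T Y.
have addvv := @mxF2_addrr 1 n.
apply: leq_trans (_ : \sum_(g in container Y T) #|translate g Y :&: W| <= _).
  rewrite -sum_nat_const; apply: leq_sum => g; rewrite inE => few.
  rewrite -(leq_add2r #|translate g Y :\: W|) cardsID card_translate cY.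
  by rewrite (_ : 4 * n = 2 * n + 2 * n) ?leq_add2l 1?ltnW //; lia.
rewrite -(card_dep_pairs _ (fun g => translate g Y :&: W)).
have inj : injective (fun p : V * V => (p.2, p.1 + p.2)%R).
  by move=> [a b] [c d] /= [-> /addIr ->].
rewrite -(card_imset _ inj); apply: leq_trans (_ : #|setX W Y| <= _).
  apply: subset_leq_card; apply/subsetP => q /imsetP[[g v]].
  by rewrite inE /= in_setI mem_translate // => /and3P[_ gv vW] ->; rewrite in_setX vW.
rewrite cardsX cY; have := card_sumset T Y; rewrite cY -/W => cW.
apply: leq_trans (leq_mul cW (leqnn _)) _.
apply: leq_trans (leq_mul (leq_mul cT (leqnn _)) (leqnn _)) _; lia.
Qed.

Lemma certificate_union_bound (l m R s : nat) (Q : pred {set V}) :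
  0 < n -> 0 < l -> 0 < m ->
  48 * (n * n) < 2 ^ s -> s * m + 4 * l <= n * R ->
  (forall A, Q A -> exists X : {set V}, [/\ #|X| = m, nz_sums X \subset A &
      basis_certificate l X \/ container_certificate R X]) ->
  #|[set A | Q A]| * 2 ^ (4 * l) <= (n.+1 * (11 * n).+1 + n.+1) * 2 ^ (2 ^ n).
Proof.
move=> n0 l0 m0 ps sm QX.
have cV : #|{: V}| = 2 ^ n by rewrite card_mx card_Fp ?mul1n.
pose code1 r q (c : 'M['F_2]_(r, n) * 'M['F_2]_(q, r)) :=
  nz_sums (rowset (c.2 *m c.1)%R).
pose bad1 r q (A : {set V}) :=
  [exists c, (r * n + q * r + 4 * l <= #|@code1 r q c|) && (code1 r q c \subset A)].
pose p := 48 * (n * n).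
(* The last component lists the positions of the elements of [X] in the enumerated container, which
   has at most [p] elements. *)
pose code2 r (c : 'M['F_2]_(r, n) * ('M['F_2]_(4 * n, r) * 'M['F_2]_(6 * r, r)) *
                {ffun 'I_m -> 'I_p.+1}) : {set V} :=
  let P := container (rowset (c.1.2.1 *m c.1.1)%R) (rowset (c.1.2.2 *m c.1.1)%R) in
  nz_sums [set nth 0%R (enum P) (c.2 i) | i in 'I_m].
pose bad2 r (A : {set V}) :=
  (R < r <= n) && [exists c, (13 * r * n <= #|@code2 r c|) && (code2 r c \subset A)].
have b1 r q : #|[set A | bad1 r q A]| * 2 ^ (4 * l) <= 2 ^ (2 ^ n).
  have := @union_bound _ V (@code1 r q) (r * n + q * r + 4 * l) (bad1 r q) _.
  rewrite cV card_prod !card_mx card_Fp // -expnD expnD mulnCA leq_pmul2l ?expn_gt0 //.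
  by apply=> A /existsP[c /andP[gc sc]]; exists c.
have b2 r : #|[set A | bad2 r A]| * 2 ^ (4 * l) <= 2 ^ (2 ^ n).
  have [Rr|nRr] := boolP (R < r <= n); last first.
    by rewrite (_ : [set A | _] = set0) ?cards0 //; apply/setP => A; rewrite !inE /bad2 (negbTE nRr).
  have := @union_bound _ V (@code2 r) (13 * r * n) (bad2 r) _.
  rewrite cV !card_prod !card_mx card_Fp // card_ffun !card_ord -!expnD => ub.
  have {ub} := ub _; set Bd := #|_| => ub.
  have {}ub : Bd * 2 ^ (13 * r * n) <=
      2 ^ (r * n + (4 * n * r + 6 * r * r)) * p.+1 ^ m * 2 ^ (2 ^ n).
    by apply: ub => A /andP[_ /existsP[c /andP[gc sc]]]; exists c.
  have pm : p.+1 ^ m <= 2 ^ (s * m) by rewrite expnM leq_expnl.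
  (* There are at most [2 ^ (12 * r * n)] codes: [11 * r * n] bits for the matrices, since [r <= n],
     and [s * m <= n * R] bits for the positions. *)
  rewrite -(@leq_pmul2l (2 ^ (12 * r * n))) ?expn_gt0 //.
  rewrite mulnCA -expnD; apply: leq_trans (_ : Bd * 2 ^ (13 * r * n) <= _).
    by rewrite leq_mul2l leq_pexp2l ?orbT //; nia.
  apply: leq_trans ub _; rewrite leq_mul2r; apply/orP; right.
  apply: leq_trans (leq_mul (leqnn _) pm) _; rewrite -expnD leq_pexp2l //; nia.
have sub : [set A | Q A] \subset
    (\bigcup_(r < n.+1) \bigcup_(q < (11 * n).+1) [set A | bad1 r q A]) :|:
    \bigcup_(r < n.+1) [set A | bad2 r A].
  apply/subsetP => A; rewrite inE => /QX[X [cX XA [|]]]; rewrite in_setU.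
    move=> [r [q [B [Y [rn qn YX YB [Yq gain]]]]]]; apply/orP; left.
    have Y0 : Y != set0.
      apply: contraTneq gain => ->; rewrite /nz_sums sumset0l set0D cards0.
      by rewrite -ltnNge; lia.
    have [D DY] := rowset_code Y0 Yq YB.
    apply/bigcupP; exists (Ordinal (rn : r < n.+1)) => //.
    apply/bigcupP; exists (Ordinal (qn : q < (11 * n).+1)) => //.
    rewrite inE; apply/existsP; exists (B, D); rewrite /code1 /= DY gain.
    exact: subset_trans YX XA.
  move=> [r [B [Y [T [/andP[Rr rn] YB TB [cY cT] [XP gain]]]]]]; apply/orP; right.
  apply/bigcupP; exists (Ordinal (rn : r < n.+1)) => //.
  rewrite inE /bad2 Rr rn /=.
  have [x0 x0X] : exists x0, x0 \in X by apply/card_gt0P; rewrite cX.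
  have Y0 : Y != set0 by rewrite -card_gt0 cY muln_gt0.
  have T0 : T != set0.
    apply: contraTneq (subsetP XP _ x0X) => ->.
    rewrite inE sumset0l setD0 card_translate cY -leqNgt.
    by rewrite leq_mul2r orbT.
  have [DY eY] := rowset_code Y0 (eq_leq cY) YB.
  have [DT eT] := rowset_code T0 cT TB.
  pose P := container Y T.
  have cP : #|P| <= p.
    apply: leq_trans (card_container n0 cY cT) _.
    by rewrite !leq_mul2l rn !orbT.
  pose f := [ffun i : 'I_m => (inord (index (nth 0%R (enum X) i) (enum P)) : 'I_p.+1)].
  have eX : [set nth 0%R (enum P) (f i) | i in 'I_m] = X.
    have fE (i : 'I_m) : nth 0%R (enum P) (f i) = nth 0%R (enum X) i.
      have iX : nth 0%R (enum X) i \in X by rewrite -mem_enum mem_nth // -cardE cX.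
      have lt : index (nth 0%R (enum X) i) (enum P) < #|P|.
        by rewrite cardE index_mem mem_enum (subsetP XP).
      rewrite ffunE inordK; first by rewrite nth_index // mem_enum (subsetP XP).
      by apply: leq_trans lt (leq_trans cP (leqnSn _)).
    apply/setP => x; apply/imsetP/idP => [[i _ ->]|xX].
      by rewrite fE -mem_enum mem_nth // -cardE cX.
    have lt : index x (enum X) < m by rewrite -cX cardE index_mem mem_enum.
    by exists (Ordinal lt); rewrite // fE /= nth_index // mem_enum.
  apply/existsP; exists (B, (DY, DT), f); rewrite /code2 /= eY eT eX gain.
  exact: XA.
apply: leq_trans (leq_mul (subset_leq_card sub) (leqnn _)) _.
apply: leq_trans (leq_mul (leq_card_setU _ _) (leqnn _)) _.
rewrite !mulnDl; apply: leq_add.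
  apply: leq_trans (leq_mul (leq_card_bigcup _ _) (leqnn _)) _.
  rewrite big_distrl -mulnA /=.
  apply: leq_trans (_ : \sum_(r < n.+1) (11 * n).+1 * 2 ^ (2 ^ n) <= _); last first.
    by rewrite sum_nat_const card_ord.
  apply: leq_sum => r _; apply: leq_trans (leq_mul (leq_card_bigcup _ _) (leqnn _)) _.
  rewrite big_distrl /=.
  apply: leq_trans (_ : \sum_(q < (11 * n).+1) 2 ^ (2 ^ n) <= _); last first.
    by rewrite sum_nat_const card_ord.
  by apply: leq_sum => q _; apply: b1.
apply: leq_trans (leq_mul (leq_card_bigcup _ _) (leqnn _)) _; rewrite big_distrl /=.
apply: leq_trans (_ : \sum_(r < n.+1) 2 ^ (2 ^ n) <= _); last first.
  by rewrite sum_nat_const card_ord.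
by apply: leq_sum => r _; apply: b2.
Qed.
End UnionBound.

(** * Second moment *)

Lemma sum_sqr_le (I : finType) (P : pred I) (x : I -> nat) :
  (\sum_(i | P i) x i) ^ 2 <= #|P| * \sum_(i | P i) x i ^ 2.
Proof.
rewrite -(@leq_pmul2l 2) // -mulnn big_distrlr big_distrr /=.
apply: leq_trans (_ : \sum_(i | P i) \sum_(j | P j) (x i ^ 2 + x j ^ 2) <= _).
  apply: leq_sum => i _; rewrite big_distrr; apply: leq_sum => j _.
  exact: nat_Cauchy.
under eq_bigr => i _ do rewrite big_split /= sum_nat_const.
by rewrite big_split /= -big_distrr /= sum_nat_const mul2n addnn.
Qed.

(** Let [X] count the [i] with [W i] inside a random set. Cauchy-Schwarz on the event [X > 0] gives
    [(E X)^2 <= P(X > 0) E X^2]; scaling by [2 ^ w] keeps everything in the naturals. *)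
Lemma second_moment (I T : finType) (W : I -> {set T}) (w : nat) :
  (forall i, #|W i| = w) ->
  #|I| ^ 2 * 2 ^ #|T| <=
  #|[set A : {set T} | [exists i, W i \subset A]]| * \sum_i \sum_j 2 ^ #|W i :&: W j|.
Proof.
move=> cW.
pose X (A : {set T}) := \sum_(i | W i \subset A) 1.
pose good := [set A : {set T} | [exists i, W i \subset A]].
have X1 : \sum_(A in good) X A * 2 ^ w = #|I| * 2 ^ #|T|.
  transitivity (\sum_(A : {set T}) X A * 2 ^ w).
    rewrite [RHS](bigID (mem good)) /= [X in _ = _ + X]big1 ?addn0 // => A.
    rewrite inE => /existsPn none; rewrite /X big1 // => i iA.
    by have := none i; rewrite iA.
  rewrite -big_distrl /= /X (exchange_big_dep predT) //= big_distrl -sum_nat_const.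
  by apply: eq_bigr => i _; rewrite /= sum1dep_card -(cW i) card_supersets.
have X2 : \sum_(A in good) X A ^ 2 * 2 ^ (2 * w) =
    2 ^ #|T| * \sum_i \sum_j 2 ^ #|W i :&: W j|.
  transitivity (\sum_(A : {set T}) X A ^ 2 * 2 ^ (2 * w)).
    rewrite [RHS](bigID (mem good)) /= [X in _ = _ + X]big1 ?addn0 // => A.
    rewrite inE => /existsPn none; rewrite /X big1 // => i iA.
    by have := none i; rewrite iA.
  rewrite -big_distrl /=.
  transitivity ((\sum_(A : {set T}) \sum_i \sum_j
      ((W i :|: W j \subset A) : nat)) * 2 ^ (2 * w)).
    congr (_ * _); apply: eq_bigr => A _; rewrite -mulnn /X big_mkcond /=.
    rewrite big_distrlr /=; apply: eq_bigr => i _; apply: eq_bigr => j _.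
    by rewrite subUset; do 2 case: (_ \subset _).
  rewrite exchange_big /= big_distrl big_distrr /=; apply: eq_bigr => i _.
  rewrite exchange_big /= big_distrl big_distrr /=; apply: eq_bigr => j _.
  rewrite -big_mkcond /= sum1dep_card -(card_supersets (W i :|: W j)) -mulnA -expnD.
  by rewrite mul2n -addnn -{1}(cW i) -(cW j) cardsUI.
have cs := @sum_sqr_le _ (mem good) (fun A => X A * 2 ^ w).
rewrite X1 in cs.
rewrite -(@leq_pmul2r (2 ^ #|T|)) ?expn_gt0 // -mulnA mulnn -expnMn.
apply: leq_trans cs _; rewrite -mulnA leq_mul2l; apply/orP; right.
by under eq_bigr do rewrite expnMn -expnM [w * 2]mulnC; rewrite X2 mulnC.
Qed.

(** * Graphs of linear maps inside a random set *)

Section LowerBound.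
Variables k p : nat.
Local Notation V := 'rV['F_2]_(k + p).

Definition graph (L : 'M['F_2]_(k, p)) : {set V} :=
  [set row_mx x (x *m L)%R | x in 'rV['F_2]_k].

Lemma graph_inj (L : 'M['F_2]_(k, p)) : injective (fun x : 'rV_k => row_mx x (x *m L)%R).
Proof. by move=> x y /eq_row_mx[]. Qed.

Lemma card_graph (L : 'M['F_2]_(k, p)) : #|graph L| = 2 ^ k.
Proof. by rewrite card_imset ?card_mx ?card_Fp ?mul1n //; apply: graph_inj. Qed.

Lemma graph0 (L : 'M['F_2]_(k, p)) : 0%R \in graph L.
Proof. by apply/imsetP; exists 0%R; rewrite // mul0mx row_mx0. Qed.

Lemma card_graphI (L L' : 'M['F_2]_(k, p)) :
  #|(graph L :\ 0%R) :&: (graph L' :\ 0%R)| <= 2 ^ \rank (kermx (L - L')%R) - 1.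
Proof.
rewrite -setDIl; have := cardsD1 0%R (graph L :&: graph L').
rewrite inE !graph0 /= add1n => e; rewrite -ltnS -e subn1 prednK ?expn_gt0 //.
apply: leq_trans (card_rowspace (B := row_base (kermx (L - L')%R))
    (X := [set x | (x <= kermx (L - L')%R)%MS]) _); last first.
  by move=> x; rewrite inE eq_row_base.
rewrite -(card_imset _ (@graph_inj L)); apply: subset_leq_card.
apply/subsetP => v; rewrite inE => /andP[/imsetP[x _ ->] /imsetP[y _]].
move=> /eq_row_mx[xy e2]; apply: imset_f; rewrite inE; apply/sub_kermxP.
by rewrite mulmxBr e2 xy subrr.
Qed.

(** With a right inverse [D'] of [D], the map from [(M, N)] to [M + D' *m N] is injective, as
    multiplication by [D] recovers [N]. *)
Lemma card_annihilated d (D : 'M['F_2]_(d, k)) : row_free D ->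
  #|[set M : 'M['F_2]_(k, p) | (D *m M == 0)%R]| * 2 ^ (d * p) <= 2 ^ (k * p).
Proof.
case/row_freeP => D' DD'.
have <- : #|{: 'M['F_2]_(d, p)}| = 2 ^ (d * p) by rewrite card_mx card_Fp.
have <- : #|{: 'M['F_2]_(k, p)}| = 2 ^ (k * p) by rewrite card_mx card_Fp.
rewrite -!cardsT -cardsX.
rewrite -(card_in_imset (f := fun q => (q.1 + D' *m q.2)%R)); first exact: subset_leq_card (subsetT _).
move=> [M N] [M' N'] /=; rewrite !inE /= !andbT => /eqP DM /eqP DM' e.
have eN : N = N'.
  have := congr1 (mulmx D) e; rewrite !mulmxDr !mulmxA DD' !mul1mx DM DM'.
  by rewrite !add0r.
by move: e; rewrite eN => /addIr ->.
Qed.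

(** The [M] are sorted by the dimension [d] of the kernel. For [d = 0] each term is 1. For [d > 0] a
    basis of the kernel has at most [2 ^ (k * d)] values, each annihilating at most a fraction
    [1 / 2 ^ (d * p)] of all matrices; by hypothesis each such [d] adds at most [1 / 2 ^ e] to the
    average. *)
Lemma sum_kernels e :
  (forall d, 0 < d <= k -> k * d + 2 ^ d + e <= d * p) ->
  (\sum_(M : 'M['F_2]_(k, p)) 2 ^ (2 ^ \rank (kermx M) - 1)) * 2 ^ e <=
    2 ^ (k * p) * (2 ^ e + k).
Proof.
move=> He.
pose rk (M : 'M['F_2]_(k, p)) : 'I_k.+1 := inord (\rank (kermx M)).
have rkE M : \rank (kermx M) = rk M by rewrite inordK // ltnS rank_leq_row.
rewrite (partition_big rk predT) //= big_ord_recl mulnDl mulnDr; apply: leq_add.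
  rewrite leq_mul2r; apply/orP; right.
  apply: leq_trans (_ : \sum_(M : 'M['F_2]_(k, p)) 1 <= _); last first.
    by rewrite sum1_card card_mx card_Fp.
  rewrite big_mkcond; apply: leq_sum => M _; case: eqP => // rM.
  by rewrite rkE rM.
rewrite big_distrl /=; apply: leq_trans (_ : \sum_(d < k) 2 ^ (k * p) <= _); last first.
  by rewrite sum_nat_const card_ord mulnC.
apply: leq_sum => d _; set d1 := lift ord0 d.
have dE : d1 = d.+1 :> nat by [].
have dk : 0 < d1 <= k by rewrite dE ltn_ord.
rewrite -(@leq_pmul2r (2 ^ (d1 * p))) ?expn_gt0 //.
apply: leq_trans (_ : 2 ^ (k * d1 + 2 ^ d1 + e) * 2 ^ (k * p) <= _); last first.
  by rewrite mulnC leq_mul2l leq_pexp2l ?orbT // He.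
have cM : #|[set M | rk M == d1]| * 2 ^ (d1 * p) <= 2 ^ (k * d1) * 2 ^ (k * p).
  have sub : [set M | rk M == d1] \subset \bigcup_(D : 'M['F_2]_(d1, k) | row_free D)
      [set M | (D *m M == 0)%R].
    apply/subsetP => M; rewrite inE => /eqP rM; apply/bigcupP.
    have [D rD DM] : exists2 D : 'M['F_2]_(d1, k), row_free D & (D *m M == 0)%R.
      rewrite -rM -rkE; exists (row_base (kermx M)); first exact: row_base_free.
      by apply/eqP/sub_kermxP; rewrite eq_row_base.
    by exists D; rewrite ?inE.
  apply: leq_trans (leq_mul (subset_leq_card sub) (leqnn _)) _.
  apply: leq_trans (leq_mul (leq_card_bigcup _ _) (leqnn _)) _.
  rewrite big_distrl /=; apply: leq_trans (_ : \sum_(D : 'M['F_2]_(d1, k)) 2 ^ (k * p) <= _).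
    by rewrite big_mkcond; apply: leq_sum => D _; case: ifP => // /card_annihilated.
  by rewrite sum_nat_const card_mx card_Fp // mulnC [d1 * k]mulnC [X in _ <= X]mulnC.
have -> : \sum_(M | rk M == d1) 2 ^ (2 ^ \rank (kermx M) - 1) =
    #|[set M | rk M == d1]| * 2 ^ (2 ^ d1 - 1).
  rewrite -sum_nat_const; apply: eq_big => [M|M /eqP rM]; first by rewrite inE.
  by rewrite rkE rM.
set cnt := #|_| in cM *.
have -> : cnt * 2 ^ (2 ^ d1 - 1) * 2 ^ e * 2 ^ (d1 * p) =
    cnt * 2 ^ (d1 * p) * 2 ^ (2 ^ d1 - 1 + e) by rewrite expnD; lia.
apply: leq_trans (leq_mul cM (leqnn _)) _.
rewrite mulnAC -expnD leq_mul2r leq_pexp2l ?orbT // -addnA leq_add2l leq_add2r.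
by rewrite leq_subr.
Qed.

Lemma graphs_in_random_set e :
  (forall d, 0 < d <= k -> k * d + 2 ^ d + e <= d * p) ->
  #|[set A : {set V} | ~~ [exists L, graph L :\ 0%R \subset A]]| * 2 ^ e <=
    k * 2 ^ (2 ^ (k + p)).
Proof.
move=> He; set good := fun A : {set V} => [exists L, graph L :\ 0%R \subset A].
have cV : #|{: V}| = 2 ^ (k + p) by rewrite card_mx card_Fp ?mul1n.
have cG L : #|graph L :\ 0%R| = 2 ^ k - 1.
  by have := cardsD1 0%R (graph L); rewrite graph0 card_graph => ->; rewrite add1n subn1.
have := second_moment cG.
rewrite cV card_mx card_Fp //; set S := \sum_i \sum_j _; set g := #|_| => sm.
have SS : S * 2 ^ e <= 2 ^ (k * p) * (2 ^ (k * p) * (2 ^ e + k)).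
  apply: leq_trans (leq_mul (leqnn _) (sum_kernels He)).
  rewrite mulnA leq_mul2r; apply/orP; right.
  rewrite -{1}[2](card_Fp (p := 2)) // -card_mx -sum_nat_const.
  (* For fixed [L], the substitution [L' = L - M] turns the inner sum into the one bounded by
     [sum_kernels]. *)
  apply: leq_sum => L _; rewrite (reindex_inj (addrI L)) (reindex_inj oppr_inj) /=.
  apply: leq_sum => M _; rewrite leq_pexp2l //.
  by apply: leq_trans (card_graphI _ _) _; rewrite opprD addrA subrr sub0r opprK.
have gE : 2 ^ (2 ^ (k + p)) * 2 ^ e <= g * (2 ^ e + k).
  rewrite -(@leq_pmul2l (2 ^ (k * p) * 2 ^ (k * p))) ?muln_gt0 ?expn_gt0 //.
  rewrite mulnn mulnA; apply: leq_trans (leq_mul sm (leqnn _)) _.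
  by rewrite -mulnA [X in _ <= X]mulnCA leq_mul2l -mulnA SS orbT.
have cP : 2 ^ (2 ^ (k + p)) = #|{: {set V}}|.
  by rewrite -cV -[#|{: V}|]cardsT -card_powerset powersetT cardsT.
have gC : #|[set A | ~~ good A]| = 2 ^ (2 ^ (k + p)) - g.
  rewrite cP -(cardsC [set A | good A]) addKn; congr #|pred_of_set _|.
  by apply/setP => A; rewrite !inE.
have gN : g <= 2 ^ (2 ^ (k + p)) by rewrite cP max_card.
rewrite gC mulnBl leq_subLR; apply: leq_trans gE _.
by rewrite mulnDr leq_add2l mulnC leq_mul2l gN orbT.
Qed.
End LowerBound.

(** * Choice of the parameters *)

(** With [b = K * d.+1] and [j = l %/ b], [l <= b * 2 ^ j] bounds [l ^ d] by [b ^ d * 2 ^ (j * d)];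
    one more factor [2 ^ j] absorbs the constant [C * b ^ d]. *)
Lemma poly_le_exp K C d : 0 < K ->
  exists l0, forall l, l0 <= l -> C * l ^ d <= 2 ^ (l %/ K).
Proof.
move=> K0; exists (K * d.+1 * (C * (K * d.+1) ^ d)) => l ll0.
set b := K * d.+1 in ll0 *; set j := l %/ b.
have b0 : 0 < b by rewrite muln_gt0 K0.
have lb : l <= b * 2 ^ j.
  apply: leq_trans (ltnW (ltn_ceil l b0)) _; rewrite mulnC leq_mul2l.
  by rewrite [_ < _](ltn_expl j (ltnSn 1)) orbT.
have Cj : C * b ^ d <= 2 ^ j.
  by apply: leq_trans (ltnW (ltn_expl j (ltnSn 1))); rewrite leq_divRL // mulnC.
apply: leq_trans (_ : C * (b ^ d * 2 ^ (j * d)) <= _).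
  by rewrite leq_mul2l expnM -expnMn leq_expnl ?orbT.
rewrite mulnA; apply: leq_trans (leq_mul Cj (leqnn _)) _.
rewrite -expnD leq_pexp2l // leq_divRL // mulnDl -mulnA -mulnDr.
have -> : K + d * K = b by rewrite /b; lia.
exact: leq_trunc_div.
Qed.

(** Monotonicity of [2 ^ j / j], which reduces the condition on all kernel dimensions to the largest
    one. *)
Lemma expn_div_mono d k : 0 < d <= k -> 2 ^ d * k <= d * 2 ^ k.
Proof.
case/andP => d0; elim: k => [|k IH]; first by rewrite muln0.
rewrite leq_eqVlt => /predU1P[-> |dk]; first by rewrite mulnC.
have {IH} := IH dk; rewrite !expnS; have : 0 < k := leq_trans d0 dk.
by nia.
Qed.

(* [l] is the integer part of [log n], [m] the size of the cliques to be excluded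
   (with [eps = 1 / q]), [tau] the popularity threshold, and [h] bounds both the
   number of discarded elements and the number of unpopular sums of the others. *)
Section Numerics.
Variables (q n l Q : nat).
Let K := 16 * q.
Let m := n * l + (n * l) %/ q.
Let h := (n * l) %/ K.
Let tau := n %/ l ^ 4.
Hypotheses (q0 : 0 < q) (ln : 2 ^ l <= n < 2 ^ l.+1).
Hypothesis l_ge : 16 * K ^ 2 + 120 <= l.
Hypothesis n_ge : 100 * l ^ 20 <= n.
Hypotheses (Q_ge : 400 <= Q) (l_geQ : 4 * 2 ^ Q <= l).
Hypothesis lam : 4 * l ^ 3 <= 2 ^ (l %/ K).

Lemma l_ge120 : 120 <= l.
Proof. exact: leq_trans (leq_addl _ _) l_ge. Qed.

Lemma K_ge : 16 <= K.
Proof. by rewrite -[16]muln1 leq_mul2l. Qed.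

Lemma K_le : 16 * (K * K) + 120 <= l.
Proof. by rewrite mulnn. Qed.

Lemma m_le : m <= 2 * n * l.
Proof. rewrite /m -mulnA; move: (n * l) (leq_div (n * l) q) => a; clear; lia. Qed.

Lemma m_ge : n * l <= m.
Proof. exact: leq_addr. Qed.

Lemma n_ge_pow d : d <= 20 -> 100 * l ^ d <= n.
Proof.
move=> d20; apply: leq_trans n_ge; rewrite leq_mul2l leq_pexp2l ?orbT //.
exact: leq_trans l_ge120.
Qed.

Lemma h_mulK_le : h * K <= n * l.
Proof. exact: leq_trunc_div. Qed.

Lemma h_mulK_ge : n * l <= 2 * K * h.
Proof.
have K0 : 0 < K by apply: leq_trans K_ge.
have Kl : 2 * K <= l by move: K_le K_ge; move: K => k; clear; nia.
have nl : l <= n * l by apply: leq_pmull; apply: leq_trans (@n_ge_pow 0 isT).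
have := ltn_ceil (n * l) K0; rewrite -/h; move: Kl nl; move: h K (n * l) => a k b.
by clear; nia.
Qed.

Lemma tau_ge : n <= 2 * (l ^ 4 * tau).
Proof.
have l40 : 0 < l ^ 4 by rewrite expn_gt0; apply/orP; left; apply: leq_trans l_ge120.
have := ltn_ceil n l40; rewrite -/tau; have := @n_ge_pow 4 isT.
by move: tau (l ^ 4) => a b; clear; nia.
Qed.

Lemma tau_le : l ^ 4 * tau <= n.
Proof. by rewrite mulnC leq_trunc_div. Qed.

(** Otherwise [M] is at most [r * n * (1 + 3/K)] and [log M] at most [l * (1 + 1/K)], so [M log M]
    is at most [r * n * l * (1 + 1/K) * (1 + 3/K)]. But [m - 2 * h] is about [n * l * (1 + 14/K)],
    because [1/q = 16/K]. *)
Lemma low_rank_growth r M :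
  r <= l ^ 3 -> m - h <= 2 ^ r -> 2 ^ (r * (m - h - h)) <= M ^ M ->
  r * n + (l ^ 6 * (l ^ 6 * (5 * l)) + tau * (5 * l)) * r + 4 * l + h + 1 <= M.
Proof.
move=> rR mr MM; rewrite leqNgt; apply/negP => small.
set q0' := l ^ 6 * _ + _ in small.
have /andP[nl nu] := ln; have mg := m_ge; have hK := h_mulK_le.
have [K0 K2l] := (K_ge, K_le).
have Kl : 16 * K <= l by move: K2l K0; move: K => k; clear; nia.
have n0 : 100 * l <= n by have := @n_ge_pow 1 isT; rewrite expn1.
have lr : l <= r.
  rewrite -(leq_exp2l _ _ (ltnSn 1)); apply: leq_trans mr; apply: leq_trans nl _.
  rewrite leq_subRL; last by move: hK mg K0; clear; nia.
  by move: hK mg K0 Kl n0; move: h m K => a b k; clear; nia.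
have lq : l * q0' <= n.
  rewrite /q0'; have := tau_le; have := @n_ge_pow 14 isT.
  have -> : l ^ 14 = l * (l ^ 6 * (l ^ 6 * l)) by rewrite -!expnSr -expnD -expnS.
  have -> : l ^ 4 = l * l * (l * l) by rewrite !mulnn -expnM.
  have -> : l * (l ^ 6 * (l ^ 6 * (5 * l)) + tau * (5 * l)) =
      5 * (l * (l ^ 6 * (l ^ 6 * l))) + 5 * (l * l * tau).
    by move: (l ^ 6) tau => a t; clear; lia.
  have ll : 10 <= l * l by move: l_ge120; clear; nia.
  have := leq_mul ll (leqnn (l * l * tau)).
  by move: (l * (l ^ 6 * _)) => y; move: (l * l) tau ll => a t; clear; lia.
have Mub : K * M <= r * n * (K + 3).
  have Kq : K * q0' <= n.
    apply: leq_trans lq; rewrite leq_mul2r; apply/orP; right.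
    by move: Kl; move: K => k; clear; lia.
  have Kh : K * h <= r * n.
    by rewrite mulnC; apply: leq_trans hK _; rewrite mulnC leq_mul2r lr orbT.
  have K4 : K * (4 * l + 1) <= r * n.
    apply: leq_trans (leq_mul lr (leqnn n)).
    move: Kl n0; move: K => k; clear; nia.
  have Kqr : K * (q0' * r) <= r * n by rewrite mulnA mulnC leq_mul2l Kq orbT.
  move: small Kh K4 Kqr; move: (q0' * r) (r * n) h K => a b c k; clear; nia.
have M2 : M <= 2 ^ (l + l %/ K).
  rewrite -(@leq_pmul2l K); last by apply: leq_trans K0.
  apply: leq_trans Mub _; rewrite expnD.
  apply: leq_trans (_ : l ^ 3 * (2 * 2 ^ l) * (2 * K) <= _).
    apply: leq_mul; last by move: K0; move: K => k; clear; lia.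
    by rewrite -expnS; apply: leq_mul rR (ltnW nu).
  move: lam; move: (2 ^ l) (l ^ 3) (2 ^ (l %/ K)) K => a b c k; clear; nia.
have logM : r * (m - h - h) <= (l + l %/ K) * M.
  rewrite -(leq_exp2l _ _ (ltnSn 1)); apply: leq_trans MM _.
  by rewrite expnM leq_expnl.
have lK := leq_trunc_div l K.
have key : K * K * (m - h - h) <= n * l * (K + 1) * (K + 3).
  have r0 : 0 < r by apply: leq_trans lr; apply: leq_trans l_ge120.
  rewrite -(leq_pmul2l r0); apply: leq_trans (_ : K * K * ((l + l %/ K) * M) <= _).
    by move: logM; rewrite mulnCA leq_mul2l => ->; rewrite orbT.
  have -> : K * K * ((l + l %/ K) * M) = (K * l + l %/ K * K) * (K * M).
    by move: (l %/ K) K => a k; clear; lia.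
  apply: leq_trans (leq_mul (leq_add (leqnn _) lK) Mub) _.
  by move: K => k; clear; lia.
have Km : (K + 16) * (n * l) <= K * m + K.
  have := ltn_ceil (n * l) q0; rewrite /m /K; move: (n * l) (_ %/ _) => a b; clear; nia.
move: key; rewrite leqNgt => /negP; apply.
have N : K * K < n * l by move: K2l n0; move: (K * K) => k; clear; nia.
rewrite -subnDA mulnBr.
move: K0 Km hK N; move: (n * l) m h K => a b c k; clear => K0 Km hK N.
have : k * k * (c + c) = 2 * k * (c * k) by lia.
nia.
Qed.

Lemma certificate_exists (X : {set 'rV['F_2]_n}) :
  #|X| = m -> basis_certificate l X \/ container_certificate (l ^ 3) X.
Proof.
move=> cX; have [r [B [C [BC BX XB]]]] := basis_of_set X.
have /andP[nl nu] := ln; have mg := m_ge; have ml := m_le.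
have l120 := l_ge120; have [K0 K2l] := (K_ge, K_le).
have tg := tau_ge; have tl := tau_le.
have n0 : 100 * l <= n by have := @n_ge_pow 1 isT; rewrite expn1.
have rn : r <= n by rewrite -{1}(rank_dual BC) rank_leq_col.
have l4 : l ^ 4 = l * l ^ 3 by rewrite expnS.
have l6 : l ^ 6 = l ^ 4 * (l * l) by rewrite mulnn -expnD.
have tau13 : 2 * (l ^ 6 * (l ^ 6 * (5 * l))) <= tau.
  rewrite /tau leq_divRL ?expn_gt0; last by rewrite (leq_trans _ l120).
  apply: leq_trans n_ge; apply: leq_trans (_ : 10 * l ^ 17 <= _).
    rewrite (_ : l ^ 17 = l ^ 6 * (l ^ 6 * l) * l ^ 4).
      by move: (l ^ 6) (l ^ 4) => a b; clear; lia.
    by rewrite -expnSr -!expnD.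
  apply: leq_trans (leq_mul (isT : 10 <= 100) (leqnn _)) _.
  exact: leq_mul (leqnn _) (leq_pexp2l (leq_trans _ l120) (isT : 17 <= 20)).
have ll0 : 0 < l * l by move: l120; clear; nia.
have tau0 : 0 < tau.
  have l0 : 0 < l by apply: leq_trans l120.
  by apply: leq_trans tau13; rewrite !muln_gt0 !l0.
have ml6 : 4 * m <= l ^ 6 * tau.
  apply: leq_trans (leq_mul (leqnn 4) ml) _; rewrite l6 [X in _ <= X]mulnAC.
  move: tg l120; move: (l ^ 4 * tau) => a; clear => na l120.
  apply: leq_trans (_ : a * (16 * l) <= _); first by nia.
  by rewrite leq_mul2l leq_mul2r (leq_trans _ l120) ?orbT.
have [rR|Rr] := leqP r (l ^ 3).
  (* With [tau] about [n / l ^ 4] and [m <= 2 * n * l], the value [l ^ 6] of [c] and [k] meets the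
     density conditions, and [5 * l] is taken for [m * m < 2 ^ (5 * l)]. The cover has at most
     [5 * l ^ 13 + 5 * l * tau] elements, which is [o(n)]. *)
  left; apply: (@low_rank_certificate n l m h tau (n %/ (8 * l)) (l ^ 3) (l ^ 6) (5 * l)
    (l ^ 6) tau X r B cX XB rn rR).
  - by apply: leq_trans mg; move: n0 l120; clear; nia.
  - have hm := leq_trans h_mulK_le mg; have : 0 < m.
      by apply: leq_trans mg; move: n0 l120; clear; nia.
    by move: hm K0; move: h m K => a b k; clear; nia.
  - have := h_mulK_ge; move: ml K2l K0; move: h m K => a b k; clear => ml K2l k16 hk.
    have k0 : 0 < 4 * (k * k) by rewrite !muln_gt0 (leq_trans _ k16).
    rewrite -(leq_pmul2l k0); apply: leq_trans (_ : n * l * (n * l) <= _).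
      apply: leq_trans (_ : 16 * (k * k) * (n * (n * l)) <= _).
        have -> : 4 * (k * k) * (2 * n * b) = 8 * (k * k) * n * b by lia.
        by apply: leq_trans (leq_mul (leqnn _) ml) _; lia.
      have -> : n * l * (n * l) = l * (n * (n * l)) by lia.
      by rewrite leq_mul2r (leq_trans _ K2l) ?orbT ?leq_addr.
    by apply: leq_trans (leq_mul hk hk) _; lia.
  - exact: tau0.
  - rewrite leq_divRL; last by move: l120; clear; lia.
    by apply: leq_trans (n_ge_pow (isT : 4 <= 20)); rewrite l4; move: (l ^ 3) => a; clear; lia.
  - have th := leq_trunc_div n (8 * l).
    have t3 : 120 * (l ^ 3 * tau) <= n.
      by apply: leq_trans tl; rewrite l4 -mulnA leq_mul2r l120 orbT.
    have mth : 4 * (m * (n %/ (8 * l))) <= n * n.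
      apply: leq_trans (leq_mul (leqnn n) th).
      by move: ml; move: (n %/ _) m => a b; clear; nia.
    move: mth t3 n0 l120; move: (m * _) (l ^ 3) tau => a b t; clear => mth t3 n0 l120.
    have := leq_mul (leqnn n) t3; nia.
  - by move: n0 l120; clear; lia.
  - rewrite -(@leq_pmul2l 2) // mulnCA.
    apply: leq_trans (_ : l ^ 6 * tau <= _).
      by apply: leq_trans ml6; rewrite leq_mul2r orbT.
    rewrite leq_mul2l; apply/orP; right; move: tau13.
    by move: (l ^ 6 * _) tau => a t; clear; lia.
  - apply: leq_ltn_trans (leq_mul ml ml) _.
    have l2 : l <= 2 ^ l := ltnW (ltn_expl l (ltnSn 1)).
    apply: leq_trans (_ : 4 * (2 ^ l.+1 * 2 ^ l.+1) * (2 ^ l * 2 ^ l) <= _).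
      move: nu l2 l120; move: (2 ^ l.+1) (2 ^ l) => a b; clear => nu l2 l120.
      have -> : 2 * n * l * (2 * n * l) = 4 * (n * n) * (l * l) by lia.
      apply: leq_ltn_trans (leq_mul (leqnn _) (leq_mul l2 l2)) _.
      have b0 : 0 < b by lia.
      by rewrite ltn_pmul2r ?muln_gt0 ?b0 // ltn_pmul2l // ltn_mul.
    rewrite (_ : 4 = 2 ^ 2) // -!expnD leq_pexp2l //; move: l120; clear; lia.
  - by rewrite mulnC; apply: leq_trans ml6; apply: leq_pmull.
  - apply: leq_trans tl; apply: leq_trans (_ : tau + tau * (5 * l) <= _).
      by rewrite leq_add2r; apply: leq_trans tau13; apply: leq_pmull.
    rewrite -mulnS mulnC leq_mul2r; apply/orP; right.
    apply: leq_trans (_ : l * l <= _); first by move: l120; clear; nia.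
    by rewrite (_ : l ^ 4 = l * l * (l * l)) ?leq_pmull // !mulnn -expnM.
  - by move=> r' M; apply: low_rank_growth.
have w30 := leq_trunc_div l 30; have J60 := leq_trunc_div l 60.
have J60' := ltn_ceil l (isT : 0 < 60).
have J0 : 0 < l %/ 60 by rewrite divn_gt0 // (leq_trans _ l120).
(* [l %/ 30] ensures [26 * w * n < n * l], [l %/ 60] ensures [2 * J <= w], and [Q >= 400] lifts
   [(2 ^ Q) ^ J] above [m < 2 ^ (2 * l + 2)]. *)
apply: (@high_rank_certificate n l m (l ^ 3) (l %/ 30) (l %/ 60) (2 ^ Q) X r B C) => //.
- by rewrite Rr.
- by apply: leq_trans mg; move: l120; clear; nia.
- by move: n0 l120; clear; lia.
- apply: leq_trans mg; have : 0 < l %/ 30 by rewrite divn_gt0 // (leq_trans _ l120).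
  by move: w30 n0 l120; move: (l %/ 30) => w; clear; nia.
- by rewrite leq_divRL //; move: J60; move: (l %/ 60) => j; clear; lia.
- rewrite leq_divRL //; move: l_geQ J60 J0 l120; move: (2 ^ Q) (l %/ 60) => c j.
  clear => lc j60 j0 l120.
  have jl : 2 * j <= l by lia.
  rewrite -mulnn !expnS expn0 muln1; apply: leq_trans (_ : (c * (l * l) + l * l) * 2 <= _).
    rewrite leq_mul2r /=; apply: leq_add; last by nia.
    by rewrite leq_mul2l leq_mul ?orbT.
  have -> : (c * (l * l) + l * l) * 2 = (2 * c + 2) * (l * l) by lia.
  by rewrite leq_mul2r; apply/orP; right; lia.
- apply: leq_ltn_trans ml _; rewrite -expnM.
  have l2 : l <= 2 ^ l := ltnW (ltn_expl l (ltnSn 1)).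
  apply: leq_trans (_ : 2 ^ (1 + l.+1 + l) <= _).
    rewrite !expnD expn1; move: nu l2 l120; move: (2 ^ l.+1) (2 ^ l) => a b.
    by clear; nia.
  rewrite leq_pexp2l //; apply: leq_trans (leq_mul Q_ge (leqnn _)).
  by move: J60' J0; move: (l %/ 60) => j; clear; lia.
Qed.
End Numerics.

(** * Cliques *)

Lemma clique_sums (V : finZmodType) (A S : {set V}) x y :
  is_clique (cayley_sum_graph A) S -> x \in S -> y \in S -> x != y -> (x + y)%R \in A.
Proof.
move=> /forall_inP cS xS yS xy; have /forall_inP/(_ y yS) := cS x xS.
by rewrite xy /cayley_sum_graph xy.
Qed.

Lemma omega_ge_clique n (A : {set 'rV['F_2]_n}) m : (m <= omega A)%N ->
  exists2 X : {set 'rV['F_2]_n}, #|X| = m & nz_sums X \subset A.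
Proof.
rewrite /omega /clique_number => mA.
have [S0 cS0 eS0] : exists2 S : {set 'rV['F_2]_n},
    is_clique (cayley_sum_graph A) S & (m <= #|S|)%N.
  have c0 : is_clique (cayley_sum_graph A) set0.
    by apply/forall_inP => x; rewrite inE.
  have ne : (0 < #|[pred S | is_clique (cayley_sum_graph A) S]|)%N.
    by apply/card_gt0P; exists set0.
  have [S cS eS] := eq_bigmax_cond (fun S : {set 'rV['F_2]_n} => #|S|) ne.
  by exists S => //; rewrite -eS.
have [X sX cX] := subset_of_card eS0.
exists X => //; apply/subsetP => v; rewrite in_setD1 => /andP[v0 /imset2P[x y xX yX ev]].
rewrite ev; apply: (clique_sums cS0); [exact: (subsetP sX) | exact: (subsetP sX) |].
by apply: contraNneq v0 => exy; rewrite ev exy mxF2_addrr.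
Qed.

Lemma omega_ge_graph k p (A : {set 'rV['F_2]_(k + p)}) L :
  graph L :\ 0%R \subset A -> (2 ^ k <= omega A)%N.
Proof.
move=> sA; rewrite -(card_graph (p := p) L); apply: leq_bigmax_cond.
apply/forall_inP => _ /imsetP[x _ ->]; apply/forall_inP => _ /imsetP[y _ ->].
apply/implyP => xy; rewrite /cayley_sum_graph xy; apply: (subsetP sA).
rewrite in_setD1; apply/andP; split.
  apply: contra xy => /eqP xy0; apply/eqP/(@addIr _ (row_mx y (y *m L)))%R.
  by rewrite xy0 mxF2_addrr.
by apply/imsetP; exists (x + y)%R; rewrite // mulmxDl add_row_mx.
Qed.

Lemma few_large_clique q : (0 < q)%N -> exists l0, forall l n, (l0 <= l)%N ->
  (2 ^ l <= n < 2 ^ l.+1)%N ->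
  (#|[set A : {set 'rV['F_2]_n} | n * l + (n * l) %/ q <= omega A]| * 2 ^ l <=
   2 ^ (2 ^ n))%N.
Proof.
move=> q0.
have [l1 H1] := poly_le_exp 100 20 (isT : 0 < 1)%N.
have [l2 H2] := @poly_le_exp (16 * q) 4 3 ltac:(by rewrite muln_gt0).
have [Q EQ] : exists Q, Q = 400 by exists 400.
exists (l1 + l2 + (16 * (16 * q) ^ 2 + 120) + 4 * 2 ^ Q)%N => l n big nl.
have l1l : (l1 <= l)%N by apply: leq_trans big; rewrite -!addnA leq_addr.
have l2l : (l2 <= l)%N by apply: leq_trans big; rewrite -!addnA addnCA leq_addr.
have l3l : (16 * (16 * q) ^ 2 + 120 <= l)%N.
  by apply: leq_trans big; rewrite -addnA addnCA leq_addr.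
have lQ : (4 * 2 ^ Q <= l)%N by apply: leq_trans big; rewrite leq_addl.
have l120 : (120 <= l)%N := leq_trans (leq_addl _ _) l3l.
have n20 : (100 * l ^ 20 <= n)%N.
  by apply: leq_trans (H1 l l1l) _; rewrite divn1; case/andP: nl.
have Q400 : (400 <= Q)%N by rewrite EQ.
have cheap := @certificate_exists q n l Q q0 nl l3l n20 Q400 lQ (H2 l l2l).
have ml := m_le q n l.
have mg : (n * l <= n * l + (n * l) %/ q)%N := leq_addr _ _.
have /andP[nlo nup] := nl.
have n0 : (0 < n)%N by apply: leq_trans nlo; rewrite expn_gt0.
have l0 : (0 < l)%N := leq_trans (isT : 0 < 120)%N l120.
have := @certificate_union_bound n l (n * l + (n * l) %/ q) (l ^ 3) (2 * l + 8)
  (fun A => n * l + (n * l) %/ q <= omega A)%N n0 l0.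
have m0 : (0 < n * l + (n * l) %/ q)%N by apply: leq_trans mg; rewrite muln_gt0 n0.
have n48 : (48 * (n * n) < 2 ^ (2 * l + 8))%N.
  rewrite (_ : 2 ^ (2 * l + 8) = 64 * (2 ^ l.+1 * 2 ^ l.+1))%N; last first.
    by rewrite (_ : 64 = 2 ^ 6)%N // -!expnD; congr (_ ^ _)%N; lia.
  by move: nup n0; move: (2 ^ l.+1)%N => a; clear; nia.
have sm : ((2 * l + 8) * (n * l + (n * l) %/ q) + 4 * l <= n * l ^ 3)%N.
  apply: leq_trans (leq_add (leq_mul (leqnn _) ml) (leqnn _)) _.
  rewrite !expnS expn0 muln1.
  apply: leq_trans (_ : n * (l * (7 * l)) <= _)%N; first by move: l120 n0; clear; nia.
  by rewrite !leq_mul2l leq_mul2r (leq_trans _ l120) ?orbT.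
move=> /(_ m0 n48 sm) ub.
set bad := [set A | _] in ub *.
have {}ub : (#|bad| * 2 ^ (4 * l) <= (n.+1 * (11 * n).+1 + n.+1) * 2 ^ (2 ^ n))%N.
  apply: ub => A mA; have [X cX XA] := omega_ge_clique mA.
  by exists X; split=> //; apply: cheap.
have a44 : (44 <= 2 ^ l)%N.
  by apply: leq_trans (ltnW (ltn_expl l (ltnSn 1))); apply: leq_trans l120.
(* The choice of [r], [q] and the kind of certificate uses up [3 * l] of the [4 * l] bits of
   slack. *)
have coef : (n.+1 * (11 * n).+1 + n.+1 <= 2 ^ (3 * l))%N.
  rewrite (_ : 3 * l = l + l + l)%N; last by clear; lia.
  rewrite !expnD; move: nup a44; rewrite expnS; move: (2 ^ l)%N => a; clear => na a44.
  apply: leq_trans (_ : 44 * (a * a) <= _)%N; first by nia.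
  by rewrite mulnC leq_mul.
rewrite -(@leq_pmul2l (2 ^ (3 * l))) ?expn_gt0 // mulnCA -expnD.
rewrite (_ : 3 * l + l = 4 * l)%N; last by clear; lia.
by apply: leq_trans ub _; rewrite leq_mul2r coef orbT.
Qed.

Lemma few_small_clique : exists l0, forall l n, (l0 <= l)%N ->
  (2 ^ l <= n < 2 ^ l.+1)%N ->
  (#|[set A : {set 'rV['F_2]_n} | omega A * 2 <= n * l.+1]| * 2 ^ l <=
   (2 * l + 2) * 2 ^ (2 ^ n))%N.
Proof.
have [l1 H1] := poly_le_exp 100 2 (isT : 0 < 1)%N.
exists (l1 + 20)%N => l n big /andP[nlo nup].
have l20 : (20 <= l)%N := leq_trans (leq_addl _ _) big.
have pl : (100 * (l * l) <= 2 ^ l)%N.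
  by rewrite mulnn -[l in X in (_ <= X)%N]divn1 H1 // (leq_trans _ big) ?leq_addr.
(* By maximality of [k], a clique of size [2 ^ k] has more than half of [n * l.+1] elements, hence
   more than [n log n / 2]. *)
pose k := trunc_log 2 (n * l.+1).
have n0 : (0 < n)%N by apply: leq_trans nlo; rewrite expn_gt0.
have nl0 : (0 < n * l.+1)%N by rewrite muln_gt0 n0.
have /andP[klo kup] := trunc_log_bounds (ltnSn 1) nl0; rewrite -/k in klo kup.
have l2 : (l.+1 <= 2 ^ l)%N := ltn_expl l (ltnSn 1).
have kl : (k <= 2 * l + 2)%N.
  rewrite -(leq_exp2l _ _ (ltnSn 1)); apply: leq_trans klo _.
  rewrite (_ : 2 * l + 2 = l.+1 + l.+1)%N; last by clear; lia.
  rewrite expnD; apply: leq_mul; first exact: ltnW.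
  by apply: leq_trans l2 _; rewrite leq_pexp2l.
have kl4 : (l + 3 <= k)%N.
  rewrite -ltnS -(ltn_exp2l _ _ (ltnSn 1)); apply: leq_ltn_trans kup.
  by rewrite expnD; apply: leq_mul => //; exact: leq_trans (isT : 8 <= 20)%N (leqW l20).
have kn : (k <= n)%N.
  apply: leq_trans kl (leq_trans _ nlo); apply: leq_trans pl; move: l20; clear; nia.
(* After multiplication by [k], monotonicity bounds [2 ^ d * k] by [d * n * l.+1], and [l + 3 <= k]
   leaves [2 * d * n] for the remaining terms. *)
have cond d : (0 < d <= k)%N -> (k * d + 2 ^ d + l <= d * (n - k))%N.
  move=> dk; have := expn_div_mono dk; have /andP[d0 _] := dk.
  have k0 : (0 < k)%N by apply: leq_trans kl4; rewrite addn3.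
  move: klo => /(leq_mul (leqnn d)) dklo /leq_trans/(_ dklo) mono.
  have kk : (2 * (k * k) + k * l <= 2 * n)%N.
    apply: leq_trans (_ : 100 * (l * l) <= _)%N; first by move: kl l20; clear; nia.
    by apply: leq_trans pl (leq_trans nlo (leq_pmull _ _)).
  have kd := leq_mul kk d0; rewrite -(leq_pmul2l k0).
  have kld := leq_mul (leqnn (d * n)) kl4.
  have lk : (k * l <= d * (k * l))%N by apply: leq_pmull.
  have kkd := leq_mul (leqnn d) kk.
  rewrite !mulnBr leq_subRL; last by rewrite leq_mul2l leq_mul2l kn !orbT.
  by move: mono kld lk kkd; move: (2 ^ d)%N => a; clear; lia.
have /= np : n = (k + (n - k))%N by rewrite subnKC.
move: (n - k) np cond => p np cond.
apply: leq_trans (_ : k * 2 ^ (2 ^ n) <= _)%N; last by rewrite leq_mul2r kl orbT.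
move: kup cond np {klo kl kl4 kn}; move: k => {}k kup cond np; subst n.
apply: leq_trans (graphs_in_random_set cond); rewrite leq_mul2r; apply/orP; right.
apply: subset_leq_card; apply/subsetP => A; rewrite !inE => small.
apply/negP => /existsP[L /omega_ge_graph big']; move: kup; rewrite ltnNge.
by rewrite (leq_trans _ small) // expnSr leq_mul2r big' orbT.
Qed.

Lemma clique_number_concentrated q N : (0 < q)%N -> exists n0, forall n, (n0 <= n)%N ->
  (#|[set A : {set 'rV['F_2]_n} |
      (n * trunc_log 2 n + (n * trunc_log 2 n) %/ q <= omega A) ||
      (omega A * 2 <= n * (trunc_log 2 n).+1)]| * N <= 2 ^ (2 ^ n))%N.
Proof.
move=> q0; have [l1 H1] := few_large_clique q0; have [l2 H2] := few_small_clique.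
(* The two bad events have total probability at most [(2 * l + 3) / 2 ^ l], and
   [2 * l + 3 <= 5 * l]. *)
have [l3 H3] := poly_le_exp (5 * N) 1 (isT : 0 < 1)%N.
exists (2 ^ (l1 + l2 + l3 + 1))%N => n nn0; set l := trunc_log 2 n.
have n0 : (0 < n)%N by apply: leq_trans nn0; rewrite expn_gt0.
have nl : (2 ^ l <= n < 2 ^ l.+1)%N by apply: trunc_log_bounds.
have ll : (l1 + l2 + l3 + 1 <= l)%N by apply: trunc_log_max.
have {}H1 := H1 l n ltac:(move: ll; clear; lia) nl.
have {}H2 := H2 l n ltac:(move: ll; clear; lia) nl.
have {}H3 := H3 l ltac:(move: ll; clear; lia).
rewrite expn1 divn1 in H3.
set B := [set A | _]; set B1 := [set A | _] in H1; set B2 := [set A | _] in H2.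
have cB : (#|B| <= #|B1| + #|B2|)%N.
  apply: leq_trans (leq_card_setU B1 B2); apply: subset_leq_card.
  by apply/subsetP => A; rewrite !inE.
rewrite -(@leq_pmul2r (2 ^ l)) ?expn_gt0 //.
apply: leq_trans (_ : N * (#|B1| * 2 ^ l + #|B2| * 2 ^ l) <= _)%N.
  by rewrite mulnAC mulnC leq_mul2l -mulnDl leq_mul2r cB !orbT.
apply: leq_trans (leq_mul (leqnn N) (leq_add H1 H2)) _.
rewrite mulnC [X in (_ <= X)%N]mulnC -mulSn mulnAC leq_mul2r; apply/orP; right.
by apply: leq_trans H3; rewrite mulnC -mulnA [X in (_ <= X)%N]mulnCA leq_mul2l; apply/orP; right; move: ll; clear; lia.
Qed.

(* Imported only now: its set notations shadow those of finset. *)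
From mathcomp Require Import all_classical all_reals all_analysis.
From mathcomp Require Import lra.
Import numFieldNormedType.Exports.
Local Open Scope classical_set_scope.
Local Open Scope ring_scope.

(** * Real probabilities and logarithms *)

Lemma random_subset_prob_half (R : realType) (T : finType) (E : pred {set T}) :
  random_subset_prob (2^-1 : R) E = #|E|%:R / 2 ^+ #|T|.
Proof.
rewrite /random_subset_prob.
under eq_bigr => A _.
  rewrite /random_subset_mass (eq_bigr (fun=> 2^-1)); last first.
    by move=> x _; case: ifP => // _; lra.
  rewrite prodr_const exprVn.
  over.
by rewrite sumr_const -[LHS]mulr_natl.
Qed.

Lemma log2_bounds (R : realType) (n : nat) : (0 < n)%N ->
  (trunc_log 2 n)%:R <= log2 (n%:R : R) <= (trunc_log 2 n).+1%:R.
Proof.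
move=> n0; have /andP[lo up] := trunc_log_bounds (ltnSn 1) n0.
have ln2 : 0 < ln (2 : R) by rewrite ln_gt0 // ltr1n.
have lnX k : ln ((2 ^ k)%:R : R) = k%:R * ln 2.
  by rewrite natrX lnXn ?ltr0n // mulr_natl.
rewrite /log2 ler_pdivlMr // ler_pdivrMr // -!lnX !ler_ln ?posrE ?ltr0n ?expn_gt0 //.
by rewrite !ler_nat lo ltnW.
Qed.

Theorem theorem1p1 (R : realType) (eps : R) (heps : 0 < eps) :
  (fun n : nat =>
     random_subset_prob (2^-1 : R)
       (fun A : {set 'rV['F_2]_n} =>
          (2^-1 * n%:R * log2 (n%:R : R) < (omega A)%:R) &&
          ((omega A)%:R < (1 + eps) * n%:R * log2 (n%:R : R))))
    @ \oo --> (1 : R).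
Proof.
apply/cvgrPdist_le => d d0.
pose q := (Num.truncn eps^-1).+1; pose N := (Num.truncn d^-1).+1.
have qe : (q%:R : R)^-1 <= eps.
  rewrite -[leRHS]invrK lef_pV2 ?posrE ?ltr0n ?invr_gt0 //.
  exact/ltW/truncnS_gt.
have Nd : (N%:R : R)^-1 <= d.
  rewrite -[leRHS]invrK lef_pV2 ?posrE ?ltr0n ?invr_gt0 //.
  exact/ltW/truncnS_gt.
have [n0 H] := @clique_number_concentrated q N isT.
exists n0.+1 => // n /= n0n; have {H} := H n (ltnW n0n).
set l := trunc_log 2 n; set B := finset _ => cB.
have nn : (0 < n)%N by apply: leq_trans n0n.
set E := fun A : {set 'rV['F_2]_n} => _ && _.
rewrite random_subset_prob_half card_mx card_Fp // mul1n.
set M := (2 ^+ (2 ^ n) : R).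
have M0 : 0 < M by rewrite exprn_gt0.
have cP : (2 ^ (2 ^ n) = #|{: {set 'rV['F_2]_n}}|)%N.
  have -> : (2 ^ n = #|{: 'rV['F_2]_n}|)%N by rewrite card_mx card_Fp ?mul1n.
  by rewrite -[#|{: 'rV__}|]cardsT -card_powerset powersetT cardsT.
have EM : #|E|%:R <= M by rewrite /M -natrX ler_nat cP max_card.
have BM : #|B|%:R <= d * M.
  apply: (@le_trans _ _ (N%:R^-1 * M)); last by rewrite ler_pM2r.
  by rewrite mulrC ler_pdivlMr ?ltr0n // /M -natrX -natrM ler_nat.
have /andP[lo up] := @log2_bounds R n nn; rewrite -/l in lo up.
(* Outside [B] the event holds: as [l <= log n <= l + 1], the lower threshold in [B] is at least
   [n log n / 2] and the upper one at most [(1 + eps) n log n]. *)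
have EB : (2 ^ (2 ^ n) <= #|E| + #|B|)%N.
  rewrite cP -(cardC (mem B)) addnC leq_add2r; apply: subset_leq_card.
  apply/fintype.subsetP => A; rewrite !inE negb_or -!ltnNge => /andP[below above].
  have n0R : 0 <= (n%:R : R) by apply: ler0n.
  rewrite unfold_in; apply/andP; split.
    have : (n * l.+1)%:R < (omega A * 2)%:R :> R by rewrite ltr_nat.
    rewrite !natrM; have := ler_wpM2l n0R up; lra.
  apply: (@lt_le_trans _ _ ((n * l + n * l %/ q)%N%:R)); first by rewrite ltr_nat.
  have fl : ((n * l %/ q)%N%:R : R) <= eps * (n * l)%:R.
    apply: (@le_trans _ _ (q%:R^-1 * (n * l)%:R)); last by rewrite ler_wpM2r.
    by rewrite mulrC ler_pdivlMr ?ltr0n // -natrM ler_nat leq_trunc_div.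
  apply: (@le_trans _ _ ((1 + eps) * (n * l)%:R)).
    by rewrite natrD mulrDl mul1r lerD2l.
  rewrite natrM -mulrA; apply: ler_wpM2l; first lra.
  exact: ler_wpM2l.
have EBM : M <= #|E|%:R + #|B|%:R by rewrite /M -natrX -natrD ler_nat.
rewrite ger0_norm; last by rewrite subr_ge0 ler_pdivrMr // mul1r.
rewrite lerBlDl -lerBlDr ler_pdivlMr // mulrBl mul1r; lra.
Qed.
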